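(* Let $\alpha>0$ and $p>2$. Set $$\nu=\frac{1}{\alpha+2},\qquad c_p=(p-2)(p-1)^{-\frac{p-1}{p-2}},\qquad D_\alpha=(\alpha+2)\,2^{-\nu}\,J_{-\nu+1}(j_{-\nu,1})\,(j_{-\nu,1})^{1+\nu}\,\Gamma(1-\nu).$$ If $$(p-1)\left(\frac{j_{-\nu,1}}{j_{\nu,1}}\right)^2+c_pD_\alpha\le 1,$$ then the one-dimensional Hénon problem $$-u''=|x|^{\alpha}u^{p-1}\ \text{ in } (-1,1),\qquad u>0\ \text{ in } (-1,1),\qquad u(-1)=u(1)=0$$ has a unique solution.
   Context: For real $\mu>-1$, $J_\mu$ is the Bessel function of the first kind of order $\mu$ and $j_{\mu,1}$ is its first positive zero; $\Gamma$ is the Gamma function. A solution is a function $u\in C^2((-1,1))\cap C([-1,1])$ satisfying the equation, the positivity and the boundary conditions pointwise. *)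

(* Defs.v *)
From Stdlib Require Import Reals Factorial.
From Coquelicot Require Import Coquelicot.
Open Scope R_scope.

(* Real power of a nonnegative base, for positive exponents.  [Rpower 0 a]
   equals 1 because [ln 0 = 0], so the value 0 at base 0 is set explicitly. *)
Definition rpow (x a : R) : R :=
  if Req_EM_T x 0 then 0 else Rpower x a.

(* Euler's integral, meaningful for [0 < s]. *)
Definition Gamma (s : R) : R :=
  RInt_gen (fun t => Rpower t (s - 1) * exp (- t))
           (at_right 0) (Rbar_locally p_infty).

(* Meaningful for [mu > -1] and [0 < x]; all Gamma arguments are then positive. *)
Definition BesselJ (mu x : R) : R :=
  Series (fun k : nat =>
    (-1) ^ k / (INR (fact k) * Gamma (INR k + mu + 1))
      * Rpower (x / 2) (2 * INR k + mu)).

(* The infimum of the positive zeros is attained when [mu > -1]. *)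
Definition bessel_zero1 (mu : R) : R :=
  real (Glb_Rbar (fun x => 0 < x /\ BesselJ mu x = 0)).

Definition nu (alpha : R) : R := 1 / (alpha + 2).

Definition c_ (p : R) : R :=
  (p - 2) * Rpower (p - 1) (- ((p - 1) / (p - 2))).

Definition D_ (alpha : R) : R :=
  (alpha + 2) * Rpower 2 (- nu alpha)
  * BesselJ (- nu alpha + 1) (bessel_zero1 (- nu alpha))
  * Rpower (bessel_zero1 (- nu alpha)) (1 + nu alpha)
  * Gamma (1 - nu alpha).

(* [ex_derive_n u 2] alone does not entail [ex_derive_n u 1], since [Derive]
   is total; hence the quantification over all orders up to 2. *)
Definition C2_open (a b : R) (u : R -> R) : Prop :=
  forall x, a < x < b ->
    (forall k : nat, (k <= 2)%nat -> ex_derive_n u k x)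
    /\ continuous (Derive_n u 2) x.

(* Functions are total on [R]; only the values on [[-1, 1]] matter. *)
Definition henon_solution (alpha p : R) (u : R -> R) : Prop :=
  C2_open (-1) 1 u
  /\ continuous_on (fun x => -1 <= x <= 1) u
  /\ (forall x, -1 < x < 1 ->
        - Derive_n u 2 x = rpow (Rabs x) alpha * rpow (u x) (p - 1))
  /\ (forall x, -1 < x < 1 -> 0 < u x)
  /\ u (-1) = 0 /\ u 1 = 0.

(* Main.v *)
Require Import Defs.
From Stdlib Require Import Reals Lra Psatz Factorial.
From Coquelicot Require Import Coquelicot.
Open Scope R_scope.

(** Put [L = M ^ (p - 2)] with [M = 2 u(0)] for a positive solution [u].  The whole argument
    compares [u] with the two lowest Dirichlet eigenfunctions of [- y'' = l |x|^alpha y]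
    on [(-1, 1)], which are Bessel functions: the even one has eigenvalue
    [l1 = ((alpha + 2) j_{-nu,1} / 2)^2], the odd one [l2 = ((alpha + 2) j_{nu,1} / 2)^2].
    Hence [l1 / l2] is the squared quotient of the hypothesis.  If [phi] is the even
    eigenfunction with [phi(0) = 1], then [D_alpha = - 2 phi'(1)] ([D_even_mode']), and [c_p] is
    the maximum of [t - t^(p-1)] ([sub_rpow_le_c]).

    A priori bound ([amplitude_bound]).  The even part is concave, so its double
    [E(x) = u(x) + u(-x)] lies between [(1 - x) M] and [M] on [[0, 1]]; in particular [u < M].
    Testing the equation for [E] against [phi], bounding [u^(p-1)] below through [c_p] and [E]
    below by the chord, and using [l1 int_0^1 x^alpha phi (1 - x) dx = 1], one gets
    [L - l1 <= L c_p D_alpha].  With the hypothesis this becomes [(p - 1) L <= l2]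
    ([spectral_gap]).

    Symmetry ([solution_even]).  The odd function [w(x) = u(x) - u(-x)] satisfies
    [- w'' = |x|^alpha q w] with [q < (p - 1) L <= l2], because [u < M].  Sturm comparison with
    the odd eigenfunction, positive on [(0, 1)], rules out [w'(0) > 0]; reflection rules out
    [w'(0) < 0]; and [w'(0) = 0] gives [w = 0] by uniqueness for the Cauchy problem.

    Uniqueness ([even_solution_unique]).  Two even solutions are rescalings
    [s u(k x)] of one another by uniqueness for the Cauchy problem, and having the same first
    zero they coincide.

    Existence ([solution_exists]).  Shoot from [y(0) = 1], [y'(0) = 0]: the solution of
    [y'' = - Lam |x|^alpha y^(p-1)] is concave and reaches [0] by [x = 1] when [Lam] is
    large; rescaling moves that zero to [1].  The Cauchy problem is solved by Picard iteration.

    The eigenfunctions are built from the power series of the Bessel functions, whose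
    coefficients are made explicit by [Gamma (s + 1) = s Gamma s]. *)

(** * One-variable calculus *)

Lemma locally_Rabs (x : R) (P : R -> Prop) :
  locally x P -> exists d, 0 < d /\ forall y, Rabs (y - x) < d -> P y.
Proof. intros [d hd]. exists d. split; [apply cond_pos | exact hd]. Qed.

(** Differentiability is needed only inside the interval and the intermediate point is interior,
    so the lemma applies to solutions at the ends [-1] and [1], where they are merely continuous. *)
Lemma mvt_open (f df : R -> R) (a b : R) :
  a < b ->
  (forall x, a < x < b -> is_derive f x (df x)) ->
  (forall x, a <= x <= b -> continuous f x) ->
  exists c, a < c < b /\ f b - f a = df c * (b - a).
Proof.
intros hab hd hc.
assert (pr1 : forall c, a < c < b -> derivable_pt f c).
{ intros c hcab. exists (df c). apply is_derive_Reals. now apply hd. }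
destruct (MVT f id a b pr1 (fun c _ => derivable_pt_id c) hab) as [c [P e]].
- intros c h. apply continuity_pt_filterlim. now apply hc.
- intros c h. apply derivable_continuous_pt, derivable_pt_id.
- exists c. split; [exact P |].
  rewrite derive_pt_id in e. unfold id in e.
  rewrite (derive_pt_eq_0 f c (df c) (pr1 c P)) in e.
  + lra.
  + apply is_derive_Reals. now apply hd.
Qed.

Lemma derive_nonpos_le (f df : R -> R) (a b : R) :
  a <= b ->
  (forall x, a < x < b -> is_derive f x (df x)) ->
  (forall x, a <= x <= b -> continuous f x) ->
  (forall x, a < x < b -> df x <= 0) -> f b <= f a.
Proof.
intros hab hd hc hn.
destruct hab as [hab | ->]; [| lra].
destruct (mvt_open f df a b hab hd hc) as [c [h1 h2]].
specialize (hn c h1). nra.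
Qed.

Lemma derive_pos_lt (f df : R -> R) (a b : R) :
  a < b ->
  (forall x, a < x < b -> is_derive f x (df x)) ->
  (forall x, a <= x <= b -> continuous f x) ->
  (forall x, a < x < b -> 0 < df x) -> f a < f b.
Proof.
intros hab hd hc hn.
destruct (mvt_open f df a b hab hd hc) as [c [h1 h2]].
specialize (hn c h1). nra.
Qed.

Lemma concave_above_chord (f df : R -> R) (a b : R) :
  (forall x, a < x < b -> is_derive f x (df x)) ->
  (forall x, a <= x <= b -> continuous f x) ->
  (forall x y, a < x -> x <= y -> y < b -> df y <= df x) ->
  forall x, a <= x <= b -> f a * (b - x) + f b * (x - a) <= f x * (b - a).
Proof.
intros hd hc hm x [[hax | ->] [hxb | ->]]; try lra.
destruct (mvt_open f df a x hax) as [c [h1 h2]].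
{ intros; apply hd; lra. } { intros; apply hc; lra. }
destruct (mvt_open f df x b hxb) as [d [h3 h4]].
{ intros; apply hd; lra. } { intros; apply hc; lra. }
assert (h5 : df d <= df c) by (apply hm; lra).
assert (h6 : (f b - f x) * (x - a) <= (f x - f a) * (b - x)).
{ rewrite h2, h4.
  assert (0 < (b - x) * (x - a)) by (apply Rmult_lt_0_compat; lra). nra. }
lra.
Qed.

(** The first zero is the supremum of the points up to which [h] stays positive. *)
Lemma first_zero (h : R -> R) (a b : R) :
  a <= b -> (forall x, a <= x <= b -> continuous h x) ->
  0 < h a -> h b <= 0 ->
  exists z, a < z <= b /\ h z = 0 /\ forall x, a <= x < z -> 0 < h x.
Proof.
intros hab hc ha hb.
set (S := fun x => a <= x <= b /\ forall y, a <= y <= x -> 0 < h y).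
assert (hSa : S a).
{ split; [lra |]. intros y hy. replace y with a by lra. exact ha. }
destruct (completeness S) as [z [hub hlub]].
{ exists b. intros x [hx _]. lra. }
{ now exists a. }
assert (haz : a <= z) by now apply hub.
assert (hzb : z <= b). { apply hlub. intros x [hx _]. lra. }
assert (hpos : forall x, a <= x < z -> 0 < h x).
{ intros x hx. destruct (Rlt_dec 0 (h x)) as [|n]; [assumption | exfalso].
  assert (z <= x); [| lra].
  apply hlub. intros y [hy1 hy2].
  destruct (Rle_dec y x); [assumption |]. exfalso. apply n, hy2. lra. }
assert (hcz : continuous h z) by (apply hc; lra).
assert (hz0 : h z = 0).
{ destruct (Rtotal_order (h z) 0) as [hn | [e | hp]]; [exfalso | exact e | exfalso].
  - assert (hz : a < z). { destruct haz as [|e]; [assumption|]. subst. lra. }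
    assert (hl : locally z (fun y => h y < 0)).
    { apply (hcz (fun y => y < 0)). now apply open_lt. }
    destruct (locally_Rabs _ _ hl) as [d [hd0 hd]].
    set (y := Rmax a (z - d / 2)).
    assert (y < z) by (unfold y; apply Rmax_lub_lt; [assumption | lra]).
    assert (a <= y) by apply Rmax_l.
    assert (z - d / 2 <= y) by apply Rmax_r.
    assert (h y < 0).
    { apply hd, Rabs_def1; lra. }
    assert (0 < h y) by (apply hpos; lra). lra.
  - assert (hz : z < b). { destruct hzb as [|e]; [assumption|]. subst. lra. }
    assert (hl : locally z (fun y => 0 < h y)).
    { apply (hcz (fun y => 0 < y)). now apply open_gt. }
    destruct (locally_Rabs _ _ hl) as [d [hd0 hd]].
    set (y := Rmin b (z + d / 2)).
    assert (z < y) by (unfold y; apply Rmin_glb_lt; [assumption | lra]).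
    assert (y <= b) by apply Rmin_l.
    assert (y <= z + d / 2) by apply Rmin_r.
    assert (y <= z); [| lra].
    apply hub. split; [lra |]. intros t ht.
    destruct (Rlt_dec t z); [apply hpos; lra |].
    apply hd, Rabs_def1; lra. }
exists z. repeat split; try assumption.
destruct haz as [|e]; [assumption |]. subst. lra.
Qed.

(** For [w = u - v] the energy [w^2 + w'^2] has derivative at most [1 + L] times itself, so
    its product with [exp (- (1 + L) x)] is nonincreasing, and it starts from [0]. *)
Lemma second_order_uniqueness (u v du dv ddu ddv : R -> R) (L b : R) :
  0 <= L ->
  (forall x, 0 <= x < b -> is_derive u x (du x) /\ is_derive v x (dv x)) ->
  (forall x, 0 <= x < b -> is_derive du x (ddu x) /\ is_derive dv x (ddv x)) ->
  (forall x, 0 <= x < b -> Rabs (ddu x - ddv x) <= L * Rabs (u x - v x)) ->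
  u 0 = v 0 -> du 0 = dv 0 ->
  forall x, 0 <= x < b -> u x = v x.
Proof.
intros hL h1 h2 hl e0 e1 x hx.
set (w := fun t => u t - v t). set (dw := fun t => du t - dv t).
set (K := 1 + L).
set (G := fun t => (w t * w t + dw t * dw t) * exp (- K * t)).
set (dG := fun t => (2 * w t * dw t + 2 * dw t * (ddu t - ddv t)
                    - K * (w t * w t + dw t * dw t)) * exp (- K * t)).
assert (hw : forall t, 0 <= t < b -> is_derive w t (dw t)).
{ intros t ht. apply (is_derive_minus u v); now apply h1. }
assert (hdw : forall t, 0 <= t < b -> is_derive dw t (ddu t - ddv t)).
{ intros t ht. apply (is_derive_minus du dv); now apply h2. }
assert (hG : forall t, 0 <= t < b -> is_derive G t (dG t)).
{ intros t ht. unfold G, dG.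
  specialize (hw t ht). specialize (hdw t ht).
  clearbody w dw. auto_derive.
  - repeat split; eexists; eassumption.
  - change (fun x0 : R => w x0) with w. change (fun x0 : R => dw x0) with dw.
    rewrite (is_derive_unique w t _ hw), (is_derive_unique dw t _ hdw).
    unfold K; ring. }
assert (hGx : G x <= G 0).
{ apply (derive_nonpos_le G dG); [lra | | |].
  - intros t ht; apply hG; lra.
  - intros t ht. apply (ex_derive_continuous G). eexists; apply hG; lra.
  - intros t ht. unfold dG.
    assert (0 < exp (- K * t)) by apply exp_pos.
    assert (hb : Rabs (ddu t - ddv t) <= L * Rabs (w t)) by (apply hl; lra).
    assert (2 * w t * dw t + 2 * dw t * (ddu t - ddv t) - K * (w t * w t + dw t * dw t) <= 0);
      [| nra].
    assert (a1 : dw t * (ddu t - ddv t) <= Rabs (dw t) * (L * Rabs (w t))).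
    { eapply Rle_trans; [apply Rle_abs |]. rewrite Rabs_mult.
      apply Rmult_le_compat_l; [apply Rabs_pos | exact hb]. }
    assert (a2 : w t * w t = Rabs (w t) * Rabs (w t)) by (rewrite <- Rabs_mult; symmetry; apply Rabs_pos_eq, Rle_0_sqr).
    assert (a3 : dw t * dw t = Rabs (dw t) * Rabs (dw t)) by (rewrite <- Rabs_mult; symmetry; apply Rabs_pos_eq, Rle_0_sqr).
    assert (a4 := Rle_0_sqr (w t - dw t)). assert (a5 := Rle_0_sqr (Rabs (w t) - Rabs (dw t))).
    unfold Rsqr in a4, a5.
    assert (a6 : 2 * (Rabs (dw t) * Rabs (w t)) <= w t * w t + dw t * dw t) by lra.
    assert (a7 : L * (2 * (Rabs (dw t) * Rabs (w t))) <= L * (w t * w t + dw t * dw t))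
      by (apply Rmult_le_compat_l; assumption).
    unfold K. lra. }
assert (G 0 = 0). { unfold G, w, dw. rewrite e0, e1. ring. }
assert (0 < exp (- K * x)) by apply exp_pos.
assert (w x * w x + dw x * dw x <= 0) by (unfold G in hGx at 1; nra).
assert (w x = 0) by nra. unfold w in *. lra.
Qed.

Lemma continuous_Rplus (f g : R -> R) x :
  continuous f x -> continuous g x -> continuous (fun t => f t + g t) x.
Proof. exact (continuous_plus f g x). Qed.

Lemma continuous_Rminus (f g : R -> R) x :
  continuous f x -> continuous g x -> continuous (fun t => f t - g t) x.
Proof. exact (continuous_minus f g x). Qed.

Lemma continuous_Rmult (f g : R -> R) x :
  continuous f x -> continuous g x -> continuous (fun t => f t * g t) x.
Proof. exact (continuous_mult f g x). Qed.

Lemma continuous_neg_arg (f : R -> R) x :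
  continuous f (- x) -> continuous (fun t => f (- t)) x.
Proof.
intros h. apply (continuous_comp Ropp f); [| exact h].
apply (ex_derive_continuous Ropp). now auto_derive.
Qed.

Lemma is_derive_scale_arg (f : R -> R) (k x l : R) :
  is_derive f (k * x) l -> is_derive (fun t => f (k * t)) x (k * l).
Proof.
intros h. apply (is_derive_comp f (fun t => k * t) x l k h).
auto_derive; [trivial | ring].
Qed.

Lemma is_derive_neg_arg (f : R -> R) (x l : R) :
  is_derive f (- x) l -> is_derive (fun t => f (- t)) x (- l).
Proof.
intros h. replace (- l) with (-1 * l) by ring.
apply (is_derive_comp f Ropp x l (-1) h).
auto_derive; [trivial | ring].
Qed.

Lemma le_at_right_end (f : R -> R) (a b K : R) :
  a < b -> continuous f b -> (forall x, a < x < b -> f x <= K) -> f b <= K.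
Proof.
intros hab hc hK. destruct (Rle_dec (f b) K) as [|n]; [assumption | exfalso].
assert (hl : locally b (fun y => K < f y)).
{ apply (hc (fun y => K < y)). apply open_gt. lra. }
destruct (locally_Rabs _ _ hl) as [d [hd0 hd]].
set (y := Rmax ((a + b) / 2) (b - d / 2)).
assert (y < b) by (apply Rmax_lub_lt; lra).
assert ((a + b) / 2 <= y) by apply Rmax_l.
assert (b - d / 2 <= y) by apply Rmax_r.
assert (K < f y).
{ apply hd, Rabs_def1; lra. }
assert (f y <= K) by (apply hK; lra). lra.
Qed.

Lemma is_derive_wronskian (f f' g g' : R -> R) (x f2 g2 : R) :
  is_derive f x (f' x) -> is_derive f' x f2 ->
  is_derive g x (g' x) -> is_derive g' x g2 ->
  is_derive (fun t => f' t * g t - f t * g' t) x (f2 * g x - f x * g2).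
Proof.
intros h1 h2 h3 h4.
replace (f2 * g x - f x * g2) with ((f2 * g x + f' x * g' x) - (f' x * g' x + f x * g2)) by ring.
apply (is_derive_minus (fun t => f' t * g t) (fun t => f t * g' t)).
- apply (is_derive_mult f' g); try assumption. intros; apply Rmult_comm.
- apply (is_derive_mult f g'); try assumption. intros; apply Rmult_comm.
Qed.

Lemma is_derive_primitive (h : R -> R) (x : R) :
  (forall t, continuous h t) -> is_derive (fun y => RInt h 0 y) x (h x).
Proof.
intros hc. apply (is_derive_RInt h (fun y => RInt h 0 y) 0 x); [| apply hc].
apply filter_forall. intros y. apply (RInt_correct h).
apply (ex_RInt_continuous h). intros; apply hc.
Qed.

(** * Truncation to the interval [-1, 1] *)

(** Composing with [clamp] turns a function that matters only on [[-1, 1]] into one that is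
    defined, continuous or Lipschitz on the whole line. *)
Definition clamp (x : R) : R := Rmax (-1) (Rmin 1 x).

Lemma clamp_id (x : R) : -1 <= x <= 1 -> clamp x = x.
Proof. intros hx. unfold clamp. rewrite Rmin_right, Rmax_right; lra. Qed.

Lemma clamp_range (x : R) : -1 <= clamp x <= 1.
Proof. unfold clamp. split; [apply Rmax_l |]. apply Rmax_lub; [lra | apply Rmin_l]. Qed.

Lemma clamp_lipschitz (x y : R) : Rabs (clamp y - clamp x) <= Rabs (y - x).
Proof.
unfold clamp, Rmax, Rmin.
repeat destruct (Rle_dec _ _); unfold Rabs; repeat destruct (Rcase_abs _); lra.
Qed.

Lemma clamp_opp (x : R) : clamp (- x) = - clamp x.
Proof. unfold clamp, Rmax, Rmin. repeat destruct (Rle_dec _ _); lra. Qed.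

Lemma continuous_clamp (x : R) : continuous clamp x.
Proof.
apply filterlim_locally. intros e. exists e. intros y hy.
eapply Rle_lt_trans; [apply clamp_lipschitz | exact hy].
Qed.

Lemma Rabs_clamp (x : R) : 0 <= Rabs (clamp x) <= 1.
Proof. split; [apply Rabs_pos |]. apply Rabs_le, clamp_range. Qed.

(** * Real powers *)

Lemma Rpower_base_1 (a : R) : Rpower 1 a = 1.
Proof. unfold Rpower. now rewrite ln_1, Rmult_0_r, exp_0. Qed.

Lemma rpow_pos (x a : R) : 0 < x -> rpow x a = Rpower x a.
Proof. intros hx. unfold rpow. destruct (Req_EM_T x 0); [lra | reflexivity]. Qed.

Lemma rpow_0 (a : R) : rpow 0 a = 0.
Proof. unfold rpow. destruct (Req_EM_T 0 0); [reflexivity | lra]. Qed.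

Lemma rpow_gt0 (x a : R) : 0 < x -> 0 < rpow x a.
Proof. intros hx. rewrite rpow_pos by assumption. apply exp_pos. Qed.

Lemma rpow_ge0 (x a : R) : 0 <= rpow x a.
Proof. unfold rpow. destruct (Req_EM_T x 0); [lra | left; apply exp_pos]. Qed.

Lemma is_derive_Rpower (x a : R) :
  0 < x -> is_derive (fun t => Rpower t a) x (a * Rpower x (a - 1)).
Proof. intros hx. apply is_derive_Reals. now apply derivable_pt_lim_power. Qed.

Lemma is_derive_rpow_abs (x a : R) :
  0 < x -> is_derive (fun t => rpow (Rabs t) a) x (a * rpow (Rabs x) (a - 1)).
Proof.
intros hx. rewrite (Rabs_pos_eq x), (rpow_pos x) by lra.
apply (is_derive_ext_loc (fun t => Rpower t a)).
- apply (filter_imp (fun t => 0 < t)).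
  + intros t ht. rewrite Rabs_pos_eq, rpow_pos by lra. reflexivity.
  + now apply open_gt.
- now apply is_derive_Rpower.
Qed.

Lemma rpow_le (x y a : R) : 0 <= a -> 0 <= x <= y -> rpow x a <= rpow y a.
Proof.
intros ha [[hx | <-] hxy].
- rewrite !rpow_pos by lra. apply Rle_Rpower_l; lra.
- rewrite rpow_0. apply rpow_ge0.
Qed.

Lemma rpow_le_1 (x a : R) : 0 <= a -> 0 <= x <= 1 -> rpow x a <= 1.
Proof.
intros ha hx. apply Rle_trans with (rpow 1 a); [now apply rpow_le |].
rewrite rpow_pos, Rpower_base_1; lra.
Qed.

Lemma rpow_1 (a : R) : rpow 1 a = 1.
Proof. rewrite rpow_pos by lra. apply Rpower_base_1. Qed.

Lemma rpow_mult_distr (x y a : R) : 0 <= x -> 0 <= y -> rpow (x * y) a = rpow x a * rpow y a.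
Proof.
intros [hx | <-] [hy | <-]; rewrite ?Rmult_0_l, ?Rmult_0_r, ?rpow_0; try ring.
rewrite !rpow_pos by nra. symmetry. now apply Rpower_mult_distr.
Qed.

Lemma rpow_succ (x a : R) : 0 <= x -> rpow x (a + 1) = x * rpow x a.
Proof.
intros [hx | <-].
- rewrite !rpow_pos, Rpower_plus, Rpower_1 by lra. ring.
- rewrite !rpow_0. ring.
Qed.

Lemma continuous_rpow_abs (a x : R) :
  0 < a -> continuous (fun t => rpow (Rabs t) a) x.
Proof.
intros ha.
assert (hp : forall y, 0 < y -> continuous (fun t => rpow (Rabs t) a) y).
{ intros y hy. apply (ex_derive_continuous (fun t => rpow (Rabs t) a)).
  eexists. now apply is_derive_rpow_abs. }
destruct (Rtotal_order x 0) as [hn | [-> | hx]]; [| | now apply hp].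
- apply (continuous_ext (fun t => rpow (Rabs (- t)) a)).
  { intros t. now rewrite Rabs_Ropp. }
  apply (continuous_comp Ropp (fun t => rpow (Rabs t) a)).
  + apply (ex_derive_continuous Ropp). now auto_derive.
  + apply hp. simpl; lra.
- apply filterlim_locally. intros [e he].
  assert (hd : 0 < Rpower e (/ a)) by apply exp_pos.
  exists (mkposreal _ hd). intros y hy.
  unfold ball in *; simpl in *; unfold AbsRing_ball, abs, minus, plus, opp in *; simpl in *.
  rewrite Rabs_R0, rpow_0, Ropp_0, Rplus_0_r.
  rewrite Ropp_0, Rplus_0_r in hy.
  rewrite Rabs_pos_eq by apply rpow_ge0.
  destruct (Req_dec y 0) as [-> | hy0].
  + now rewrite Rabs_R0, rpow_0.
  + assert (0 < Rabs y) by now apply Rabs_pos_lt.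
    rewrite rpow_pos by assumption.
    apply Rlt_le_trans with (Rpower (Rpower e (/ a)) a).
    * unfold Rpower at 1 2. apply exp_increasing. apply Rmult_lt_compat_l; [assumption|].
      now apply ln_increasing.
    * rewrite Rpower_mult, Rinv_l, Rpower_1 by lra. lra.
Qed.

Lemma rpow_mvt (x y q : R) :
  0 < x -> x < y -> exists c, x < c < y /\ rpow y q - rpow x q = q * Rpower c (q - 1) * (y - x).
Proof.
intros hx hxy. rewrite !rpow_pos by lra.
apply (mvt_open (fun t => Rpower t q) (fun c => q * Rpower c (q - 1)) x y hxy).
- intros t ht. apply is_derive_Rpower. lra.
- intros t ht. apply (ex_derive_continuous (fun t => Rpower t q)).
  eexists. apply is_derive_Rpower. lra.
Qed.

(** Strict because the mean value point lies strictly below [M]; this strictness is what makes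
    the Sturm comparison work when [(p - 1) L = l2]. *)
Lemma rpow_diff_lt (x y M q : R) :
  1 < q -> 0 < x -> x < y -> y <= M ->
  rpow y q - rpow x q < q * Rpower M (q - 1) * (y - x).
Proof.
intros hq hx hxy hM. destruct (rpow_mvt x y q hx hxy) as [c [hc ->]].
apply Rmult_lt_compat_r; [lra |]. apply Rmult_lt_compat_l; [lra |].
unfold Rpower. apply exp_increasing, Rmult_lt_compat_l; [lra |]. apply ln_increasing; lra.
Qed.

(** The case of a zero argument is separate because the function is differentiated only on the
    positive half-line. *)
Lemma rpow_lipschitz (x y M q : R) :
  1 < q -> 0 <= x <= M -> 0 <= y <= M -> 0 < M ->
  Rabs (rpow x q - rpow y q) <= q * Rpower M (q - 1) * Rabs (x - y).
Proof.
intros hq.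
assert (hlt : forall x y, 0 <= x -> x < y -> y <= M -> 0 < M ->
  rpow y q - rpow x q <= q * Rpower M (q - 1) * (y - x)).
{ clear x y. intros x y [hx | <-] hxy hM hM0.
  - left. now apply rpow_diff_lt.
  - rewrite rpow_0, !Rminus_0_r.
    replace (rpow y q) with (y * Rpower y (q - 1)).
    + assert (Rpower y (q - 1) <= Rpower M (q - 1)) by (apply Rle_Rpower_l; lra).
      assert (0 < Rpower M (q - 1)) by apply exp_pos.
      assert (y * Rpower y (q - 1) <= y * Rpower M (q - 1)) by (apply Rmult_le_compat_l; lra).
      assert (0 <= (q - 1) * (y * Rpower M (q - 1))) by (apply Rmult_le_pos; nra). lra.
    + replace q with (q - 1 + 1) at 2 by ring. now rewrite rpow_succ, rpow_pos by lra. }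
intros hx hy hM.
destruct (Rtotal_order x y) as [h | [-> | h]].
- rewrite (Rabs_minus_sym x y), (Rabs_minus_sym (rpow x q)).
  rewrite (Rabs_pos_eq (y - x)) by lra.
  rewrite Rabs_pos_eq; [apply hlt; lra |].
  assert (rpow x q <= rpow y q) by (apply rpow_le; lra). lra.
- rewrite !Rminus_diag, Rabs_R0. lra.
- rewrite (Rabs_pos_eq (x - y)) by lra.
  rewrite Rabs_pos_eq; [apply hlt; lra |].
  assert (rpow y q <= rpow x q) by (apply rpow_le; lra). lra.
Qed.

(** The function [t - t^(p-1)] is maximal where [(p - 1) t^(p-2) = 1], and [c_ p] is its value there. *)
Lemma sub_rpow_le_c (p t : R) : 2 < p -> 0 < t -> t - rpow t (p - 1) <= c_ p.
Proof.
intros hp ht.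
set (t0 := Rpower (p - 1) (- / (p - 2))).
assert (h0 : 0 < t0) by apply exp_pos.
assert (e1 : Rpower t0 (p - 2) = / (p - 1)).
{ unfold t0. rewrite Rpower_mult.
  replace (- / (p - 2) * (p - 2)) with (- (1)) by (field; lra).
  rewrite Rpower_Ropp, Rpower_1; lra. }
assert (e2 : rpow t0 (p - 1) = t0 / (p - 1)).
{ replace (p - 1) with (p - 2 + 1) at 1 by ring.
  rewrite rpow_succ, rpow_pos, e1 by lra. reflexivity. }
assert (e3 : c_ p = t0 - rpow t0 (p - 1)).
{ rewrite e2. unfold c_, t0.
  replace (- ((p - 1) / (p - 2))) with (- / (p - 2) + - (1)) by (field; lra).
  rewrite Rpower_plus, (Rpower_Ropp _ 1), Rpower_1 by lra. field. lra. }
rewrite e3.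
assert (hm : forall a b, 0 < a < b -> Rpower a (p - 2) < Rpower b (p - 2)).
{ intros a b hab. unfold Rpower. apply exp_increasing, Rmult_lt_compat_l; [lra |].
  apply ln_increasing; lra. }
destruct (Rtotal_order t t0) as [h | [-> | h]]; [| lra |].
- destruct (rpow_mvt t t0 (p - 1) ht h) as [c [hc e]].
  assert (h1 : Rpower c (p - 2) < / (p - 1)) by (rewrite <- e1; apply hm; lra).
  replace (p - 1 - 1) with (p - 2) in e by ring.
  apply (Rmult_lt_compat_l (p - 1)) in h1; [rewrite Rinv_r in h1 |]; [| lra | lra].
  nra.
- destruct (rpow_mvt t0 t (p - 1) h0 h) as [c [hc e]].
  assert (h1 : / (p - 1) < Rpower c (p - 2)) by (rewrite <- e1; apply hm; lra).
  replace (p - 1 - 1) with (p - 2) in e by ring.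
  apply (Rmult_lt_compat_l (p - 1)) in h1; [rewrite Rinv_r in h1 |]; [| lra | lra].
  nra.
Qed.

(** * The Gamma function *)

(** The integral over [[a, b]] grows with the interval, so the improper integral is the supremum
    of these values. *)
Lemma is_RInt_gen_of_bounded (f : R -> R) (B : R) :
  (forall t, 0 < t -> continuous f t) ->
  (forall t, 0 < t -> 0 < f t) ->
  (forall a b, 0 < a -> a <= 1 -> 1 <= b -> RInt f a b <= B) ->
  exists l, 0 < l /\ is_RInt_gen f (at_right 0) (Rbar_locally p_infty) l.
Proof.
intros hc hp hB.
assert (hex : forall a b, 0 < a -> 0 < b -> ex_RInt f a b).
{ intros a b ha hb. apply (ex_RInt_continuous f). intros z hz. apply hc.
  assert (0 < Rmin a b) by now apply Rmin_pos. lra. }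
assert (hmono : forall a b c d, 0 < a -> a <= b -> b <= c -> c <= d -> RInt f b c <= RInt f a d).
{ intros a b c d h1 h2 h3 h4.
  assert (p1 : 0 <= RInt f a b).
  { apply RInt_ge_0; [lra | apply hex; lra |]. intros; left; apply hp; lra. }
  assert (p2 : 0 <= RInt f c d).
  { apply RInt_ge_0; [lra | apply hex; lra |]. intros; left; apply hp; lra. }
  assert (q1 := RInt_Chasles f a b d (hex a b ltac:(lra) ltac:(lra)) (hex b d ltac:(lra) ltac:(lra))).
  assert (q2 := RInt_Chasles f b c d (hex b c ltac:(lra) ltac:(lra)) (hex c d ltac:(lra) ltac:(lra))).
  unfold plus in *; simpl in *. lra. }
set (S := fun y => exists a b, 0 < a /\ a <= 1 /\ 1 <= b /\ y = RInt f a b).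
destruct (completeness S) as [l [hub hlub]].
{ exists B. intros y (a & b & h1 & h2 & h3 & ->). now apply hB. }
{ exists (RInt f 1 1), 1, 1. repeat split; lra. }
exists l. split.
- apply Rlt_le_trans with (RInt f 1 2).
  + apply RInt_gt_0; [lra | |]; intros; [apply hp | apply hc]; lra.
  + apply hub. exists 1, 2. repeat split; lra.
- intros P [e he].
  assert (hne : exists a b, 0 < a /\ a <= 1 /\ 1 <= b /\ l - e < RInt f a b).
  { apply Classical_Prop.NNPP. intros hn.
    assert (l <= l - e); [| destruct e; simpl in *; lra].
    apply hlub. intros y (a & b & h1 & h2 & h3 & ->).
    destruct (Rle_dec (RInt f a b) (l - e)); [assumption |].
    exfalso. apply hn. exists a, b. repeat split; lra. }
  destruct hne as (a0 & b0 & h1 & h2 & h3 & h4).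
  exists (fun a => 0 < a < a0) (fun b => b0 < b).
  + exists (mkposreal a0 h1). intros y hy hy0.
    unfold ball in hy; simpl in hy; unfold AbsRing_ball, abs, minus, plus, opp in hy; simpl in hy.
    apply Rabs_def2 in hy. lra.
  + now exists b0.
  + intros a b ha hb. simpl. exists (RInt f a b). split.
    * apply (RInt_correct f), hex; lra.
    * apply he. unfold ball; simpl; unfold AbsRing_ball, abs, minus, plus, opp; simpl.
      assert (RInt f a b <= l) by (apply hub; exists a, b; repeat split; lra).
      assert (RInt f a0 b0 <= RInt f a b) by (apply hmono; lra).
      destruct e; simpl in *. apply Rabs_def1; lra.
Qed.

(** From [ln t <= t / (2 a') - 1 + ln (2 a')], with [a' > 0] dominating [a]. *)
Lemma Rpower_exp_bound (a : R) :
  exists C, 0 < C /\ forall t, 1 <= t -> Rpower t a * exp (- t) <= C * exp (- (t / 2)).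
Proof.
(* Shifting by [1] keeps [a'] positive when [a = 0]. *)
set (a' := Rabs a + 1).
assert (ha' : 0 < a') by (unfold a'; assert (h := Rabs_pos a); lra).
exists (exp (a' * ln (2 * a'))). split; [apply exp_pos |].
intros t ht. unfold Rpower. rewrite <- !exp_plus.
assert (h1 : 0 <= ln t).
{ rewrite <- ln_1. destruct ht as [ht | <-]; [left; apply ln_increasing |]; lra. }
assert (h2 : a * ln t <= a' * ln t).
{ apply Rmult_le_compat_r; [assumption |]. unfold a'. assert (h := Rle_abs a). lra. }
assert (h3 : ln (t / (2 * a')) <= t / (2 * a') - 1).
{ assert (h := exp_ineq1_le (ln (t / (2 * a')))). rewrite exp_ln in h; [lra |].
  apply Rdiv_lt_0_compat; lra. }
rewrite ln_div in h3 by lra.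
assert (h4 : a' * (t / (2 * a')) = t / 2) by (field; lra).
assert (h5 : a' * (ln t - ln (2 * a')) <= a' * (t / (2 * a') - 1)) by (apply Rmult_le_compat_l; lra).
assert (h6 : a * ln t + - t <= a' * ln (2 * a') + - (t / 2)) by lra.
destruct h6 as [h6 | ->]; [left; now apply exp_increasing | lra].
Qed.

Definition gamma_integrand (s t : R) : R := Rpower t (s - 1) * exp (- t).

Lemma continuous_gamma_integrand (s t : R) : 0 < t -> continuous (gamma_integrand s) t.
Proof.
intros ht. unfold gamma_integrand.
apply (continuous_mult (fun t => Rpower t (s - 1)) (fun t => exp (- t))).
- apply (ex_derive_continuous (fun t => Rpower t (s - 1))). eexists. now apply is_derive_Rpower.
- apply (ex_derive_continuous (fun t => exp (- t))). now auto_derive.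
Qed.

(** Near [0] the integrand is at most [t^(s-1)], whose primitive is [t^s / s]; from [1] on it is
    at most a multiple of [exp (- t / 2)]. *)
Lemma gamma_converges (s : R) : 0 < s ->
  exists l, 0 < l /\ is_RInt_gen (gamma_integrand s) (at_right 0) (Rbar_locally p_infty) l.
Proof.
intros hs. destruct (Rpower_exp_bound (s - 1)) as [C [hC hb]].
apply (is_RInt_gen_of_bounded _ (/ s + 2 * C)).
- intros t ht. now apply continuous_gamma_integrand.
- intros t ht. apply Rmult_lt_0_compat; apply exp_pos.
- intros a b ha ha1 hb1.
  assert (hex : forall a b, 0 < a -> 0 < b -> ex_RInt (gamma_integrand s) a b).
  { intros x y hx hy. apply (ex_RInt_continuous (gamma_integrand s)). intros z hz.
    apply continuous_gamma_integrand.
    assert (0 < Rmin x y) by now apply Rmin_pos. lra. }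
  assert (q := RInt_Chasles (gamma_integrand s) a 1 b (hex a 1 ltac:(lra) ltac:(lra)) (hex 1 b ltac:(lra) ltac:(lra))).
  unfold plus in q; simpl in q. rewrite <- q. apply Rplus_le_compat.
  + assert (hi : is_RInt (fun t => Rpower t (s - 1)) a 1 (Rpower 1 s / s - Rpower a s / s)).
    { apply (is_RInt_derive (fun t => Rpower t s / s) (fun t => Rpower t (s - 1))).
      - intros x. rewrite Rmin_left, Rmax_right by assumption. intros hx.
        replace (Rpower x (s - 1)) with (/ s * (s * Rpower x (s - 1))) by (field; lra).
        apply (is_derive_ext (fun t => / s * Rpower t s)). { intros; apply Rmult_comm. }
        apply is_derive_scal, is_derive_Rpower. lra.
      - intros x. rewrite Rmin_left, Rmax_right by assumption. intros hx.
        apply (ex_derive_continuous (fun t => Rpower t (s - 1))). eexists. apply is_derive_Rpower. lra. }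
    apply Rle_trans with (Rpower 1 s / s - Rpower a s / s).
    * rewrite <- (is_RInt_unique _ _ _ _ hi). apply RInt_le; [assumption | apply hex; lra | eexists; exact hi |].
      intros x hx. unfold gamma_integrand.
      assert (exp (- x) <= 1) by (rewrite <- exp_0; left; apply exp_increasing; lra).
      assert (0 < Rpower x (s - 1)) by apply exp_pos. nra.
    * rewrite Rpower_base_1.
      assert (0 < Rpower a s / s) by (apply Rdiv_lt_0_compat; [apply exp_pos | assumption]).
      unfold Rdiv in *. lra.
  + assert (hi : is_RInt (fun t => C * exp (- (t / 2))) 1 b (- 2 * C * exp (- (b / 2)) - - 2 * C * exp (- (1 / 2)))).
    { apply (is_RInt_derive (fun t => - 2 * C * exp (- (t / 2))) (fun t => C * exp (- (t / 2)))).
        - intros x _. auto_derive; [trivial |]. unfold Rdiv. field.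
      - intros x _. apply (ex_derive_continuous (fun t => C * exp (- (t / 2)))). now auto_derive. }
    apply Rle_trans with (- 2 * C * exp (- (b / 2)) - - 2 * C * exp (- (1 / 2))).
    * rewrite <- (is_RInt_unique _ _ _ _ hi). apply RInt_le; [assumption | apply hex; lra | eexists; exact hi |].
      intros x hx. apply hb. lra.
    * assert (exp (- (1 / 2)) <= 1).
      { assert (h := exp_increasing (- (1 / 2)) 0). rewrite exp_0 in h. lra. }
      assert (h := exp_pos (- (b / 2))).
      assert (0 < C * exp (- (b / 2))) by now apply Rmult_lt_0_compat.
      assert (C * exp (- (1 / 2)) <= C * 1) by (apply Rmult_le_compat_l; lra). lra.
Qed.

Lemma Gamma_is_integral (s : R) : 0 < s ->
  is_RInt_gen (gamma_integrand s) (at_right 0) (Rbar_locally p_infty) (Gamma s).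
Proof.
intros hs. destruct (gamma_converges s hs) as [l [_ hl]].
unfold Gamma. fold (gamma_integrand s).
now rewrite (is_RInt_gen_unique _ _ hl).
Qed.

Lemma Gamma_pos (s : R) : 0 < s -> 0 < Gamma s.
Proof.
intros hs. destruct (gamma_converges s hs) as [l [hl0 hl]].
unfold Gamma. fold (gamma_integrand s).
now rewrite (is_RInt_gen_unique _ _ hl).
Qed.

(** Integration by parts: [t^s exp (- t)] vanishes at both ends. *)
Lemma Gamma_succ (s : R) : 0 < s -> Gamma (s + 1) = s * Gamma s.
Proof.
intros hs.
set (F := fun t => Rpower t s * exp (- t)).
assert (hF : forall t, 0 < t -> is_derive F t (s * gamma_integrand s t - gamma_integrand (s + 1) t)).
{ intros t ht. unfold F, gamma_integrand.
  replace (s + 1 - 1) with s by ring.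
  replace (s * (Rpower t (s - 1) * exp (- t)) - Rpower t s * exp (- t))
    with (s * Rpower t (s - 1) * exp (- t) + Rpower t s * (- exp (- t))) by ring.
  apply (is_derive_mult (fun t => Rpower t s) (fun t => exp (- t))).
  - now apply is_derive_Rpower.
  - auto_derive; [trivial | ring].
  - intros; apply Rmult_comm. }
assert (hlim0 : filterlim F (at_right 0) (locally 0)).
{ assert (hc := continuous_rpow_abs s 0 hs). unfold continuous in hc. rewrite Rabs_R0, rpow_0 in hc.
  apply filterlim_locally. intros e.
  destruct (proj1 (filterlim_locally _ _) hc e) as [d hd].
  exists d. intros y hy hy0. specialize (hd y hy).
  unfold ball in *; simpl in *; unfold AbsRing_ball, abs, minus, plus, opp in *; simpl in *.
  rewrite Ropp_0, Rplus_0_r in *.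
  rewrite (Rabs_pos_eq y), rpow_pos in hd by lra.
  eapply Rle_lt_trans; [| exact hd]. unfold F.
  assert (0 < Rpower y s) by apply exp_pos. assert (0 < exp (- y)) by apply exp_pos.
  rewrite !Rabs_pos_eq by nra.
  assert (exp (- y) <= 1) by (rewrite <- exp_0; left; apply exp_increasing; lra). nra. }
assert (hlim1 : filterlim F (Rbar_locally p_infty) (locally 0)).
{ destruct (Rpower_exp_bound s) as [C [hC hb]].
  apply filterlim_locally. intros [e he].
  exists (Rmax 1 (2 * C / e)). intros y hy.
  assert (h1 := Rmax_l 1 (2 * C / e)). assert (h2 := Rmax_r 1 (2 * C / e)).
  unfold ball; simpl; unfold AbsRing_ball, abs, minus, plus, opp; simpl.
  rewrite Ropp_0, Rplus_0_r.
  specialize (hb y ltac:(lra)). fold (F y) in hb.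
  rewrite Rabs_pos_eq by (apply Rmult_le_pos; left; apply exp_pos).
  eapply Rle_lt_trans; [exact hb |].
  assert (h3 := exp_ineq1_le (y / 2)).
  assert (h4 : 2 * C < e * y).
  { apply (Rmult_lt_reg_r (/ e)); [now apply Rinv_0_lt_compat |].
    replace (e * y * / e) with y by (field; lra). unfold Rdiv in h2. lra. }
  rewrite exp_Ropp. apply (Rmult_lt_reg_r (exp (y / 2))); [apply exp_pos |].
  rewrite Rmult_assoc, Rinv_l by (assert (h := exp_pos (y / 2)); lra). nra. }
assert (hprod : forall P : R * R -> Prop, (forall a b, 0 < a -> 0 < b -> P (a, b)) ->
  filter_prod (at_right 0) (Rbar_locally p_infty) P).
{ intros P hP. exists (fun a => 0 < a) (fun b => 0 < b).
  - exists (mkposreal 1 Rlt_0_1). now intros.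
  - now exists 0.
  - exact hP. }
assert (hmin : forall a b x, 0 < a -> 0 < b -> Rmin a b <= x -> 0 < x).
{ intros a b x ha hb hx. assert (0 < Rmin a b) by now apply Rmin_pos. lra. }
assert (hI := is_RInt_gen_Derive (Fa := at_right 0) (Fb := Rbar_locally p_infty) F 0 0).
assert (hJ : is_RInt_gen (Derive F) (at_right 0) (Rbar_locally p_infty) (0 - 0)).
{ apply hI; [| | assumption | assumption]; apply hprod; simpl; intros a b ha hb x [hx _];
    specialize (hmin a b x ha hb hx).
  - eexists. now apply hF.
  - apply (continuous_ext_loc _ (fun t => s * gamma_integrand s t - gamma_integrand (s + 1) t)).
    + apply (filter_imp (fun t => 0 < t)); [| now apply open_gt].
      intros t ht. symmetry. apply is_derive_unique. now apply hF.
    + apply (continuous_minus (fun t => s * gamma_integrand s t) (gamma_integrand (s + 1)));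
        [| now apply continuous_gamma_integrand].
      apply (continuous_scal_r s (gamma_integrand s)). now apply continuous_gamma_integrand. }
assert (hK := is_RInt_gen_plus _ _ _ _ hJ (Gamma_is_integral (s + 1) ltac:(lra))).
assert (hS : is_RInt_gen (fun y => s * gamma_integrand s y) (at_right 0) (Rbar_locally p_infty)
  (s * Gamma s)) by exact (is_RInt_gen_scal _ s _ (Gamma_is_integral s hs)).
assert (hT : is_RInt_gen (fun y => s * gamma_integrand s y) (at_right 0) (Rbar_locally p_infty)
  (plus (0 - 0) (Gamma (s + 1)))).
{ refine (is_RInt_gen_ext _ _ _ _ hK). apply hprod. simpl. intros a b ha hb x hx.
  rewrite (is_derive_unique _ _ _ (hF x (hmin a b x ha hb (Rlt_le _ _ (proj1 hx))))).
  unfold plus; simpl. ring. }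
rewrite <- (is_RInt_gen_unique (V := R_CompleteNormedModule) (fun y => s * gamma_integrand s y) _ hS).
rewrite (is_RInt_gen_unique (V := R_CompleteNormedModule) (fun y => s * gamma_integrand s y) _ hT).
unfold plus; simpl. ring.
Qed.

(** * Power series of the Bessel functions *)

Fixpoint rising (a : R) (k : nat) : R :=
  match k with O => 1 | S n => rising a n * (a + INR n) end.

Lemma rising_pos (a : R) (k : nat) : 0 < a -> 0 < rising a k.
Proof.
intros ha. induction k as [| k IH]; simpl; [lra |].
apply Rmult_lt_0_compat; [assumption |]. assert (h := pos_INR k). lra.
Qed.

Lemma rising_shift (a : R) (k : nat) : rising a (S k) = a * rising (a + 1) k.
Proof.
induction k as [| k IH].
- simpl. ring.
- change (rising a (S (S k))) with (rising a (S k) * (a + INR (S k))).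
  change (rising (a + 1) (S k)) with (rising (a + 1) k * (a + 1 + INR k)).
  rewrite IH, S_INR. ring.
Qed.

Definition bcoef (mu : R) (k : nat) : R := (-1) ^ k / (INR (fact k) * rising (mu + 1) k).

(** The hypergeometric function 0F1 with parameter [mu + 1] at [- z]; up to a constant and the
    factor [(x / 2)^mu], this is [BesselJ mu x] when [z = (x / 2)^2]. *)
Definition bseries (mu z : R) : R := PSeries (bcoef mu) z.

Lemma bcoef_neq0 (mu : R) (k : nat) : -1 < mu -> bcoef mu k <> 0.
Proof.
intros hmu. unfold bcoef. assert (h := rising_pos (mu + 1) k ltac:(lra)).
assert (h' := INR_fact_lt_0 k).
apply Rmult_integral_contrapositive. split; [apply pow_nonzero; lra |].
apply Rinv_neq_0_compat. nra.
Qed.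

Lemma bcoef_succ (mu : R) (k : nat) : -1 < mu ->
  bcoef mu (S k) = - bcoef mu k / (INR (S k) * (mu + 1 + INR k)).
Proof.
intros hmu. unfold bcoef.
assert (h := rising_pos (mu + 1) k ltac:(lra)).
assert (h' := INR_fact_lt_0 k). assert (hk := pos_INR k).
rewrite fact_simpl, mult_INR. simpl rising. rewrite <- tech_pow_Rmult.
assert (0 < INR (S k)) by (apply lt_0_INR; lia).
field. repeat split; lra.
Qed.

Lemma bcoef_lower (mu : R) (k : nat) : -1 < mu ->
  (mu + 1 + INR k) * bcoef (mu + 1) k = (mu + 1) * bcoef mu k.
Proof.
intros hmu. unfold bcoef.
assert (h := rising_pos (mu + 1) k ltac:(lra)).
assert (h1 := rising_pos (mu + 1 + 1) k ltac:(lra)).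
assert (h' := INR_fact_lt_0 k). assert (hk := pos_INR k).
assert (e := rising_shift (mu + 1) k). simpl in e.
apply (Rmult_eq_reg_r (rising (mu + 1) k * rising (mu + 1 + 1) k)); [| nra].
transitivity ((-1) ^ k / INR (fact k) * (rising (mu + 1) k * (mu + 1 + INR k))); [field; lra |].
rewrite e. field. lra.
Qed.

Lemma CV_radius_bcoef (mu : R) : -1 < mu -> CV_radius (bcoef mu) = p_infty.
Proof.
intros hmu. apply CV_radius_infinite_DAlembert.
- intros n. now apply bcoef_neq0.
- apply is_lim_seq_le_le with (u := fun _ => 0) (w := fun n => / (mu + 1) * / (INR n + 1)).
  + intros n. assert (h := bcoef_neq0 mu n hmu). assert (hn := pos_INR n).
    rewrite bcoef_succ, S_INR by assumption.
    replace (- bcoef mu n / ((INR n + 1) * (mu + 1 + INR n)) / bcoef mu n)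
      with (- (/ (mu + 1 + INR n) * / (INR n + 1))) by (field; repeat split; lra).
    rewrite Rabs_Ropp.
    assert (0 < / (mu + 1 + INR n)) by (apply Rinv_0_lt_compat; lra).
    assert (0 < / (INR n + 1)) by (apply Rinv_0_lt_compat; lra).
    rewrite Rabs_pos_eq by nra. split; [nra |].
    apply Rmult_le_compat_r; [lra |]. apply Rinv_le_contravar; lra.
  + apply is_lim_seq_const.
  + replace (Finite 0) with (Rbar_mult (/ (mu + 1)) 0) by (simpl; f_equal; ring).
    apply is_lim_seq_scal_l.
    apply (is_lim_seq_ext (fun n => / INR (S n))). { intros n. now rewrite S_INR. }
    apply -> (is_lim_seq_incr_1 (fun n => / INR n)).
    apply (is_lim_seq_inv INR p_infty); [apply is_lim_seq_INR | discriminate].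
Qed.

Lemma bseries_0 (mu : R) : bseries mu 0 = 1.
Proof. unfold bseries. rewrite PSeries_0. unfold bcoef. simpl. field. Qed.

Lemma is_derive_bseries (mu z : R) : -1 < mu ->
  is_derive (bseries mu) z (- bseries (mu + 1) z / (mu + 1)).
Proof.
intros hmu.
replace (- bseries (mu + 1) z / (mu + 1)) with (PSeries (PS_derive (bcoef mu)) z).
- apply is_derive_PSeries. now rewrite CV_radius_bcoef.
- unfold bseries. replace (- PSeries (bcoef (mu + 1)) z / (mu + 1))
    with (- / (mu + 1) * PSeries (bcoef (mu + 1)) z) by (field; lra).
  rewrite <- PSeries_scal. apply PSeries_ext. intros n.
  unfold PS_derive, PS_scal, scal; simpl; unfold mult; simpl.
  assert (hn := pos_INR n).
  change (match n with O => 1 | S _ => INR n + 1 end) with (INR (S n)).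
  rewrite bcoef_succ by assumption.
  assert (e := bcoef_lower mu n hmu).
  assert (0 < INR (S n)) by (apply lt_0_INR; lia).
  apply (Rmult_eq_reg_l (mu + 1)); [| lra].
  transitivity (- ((mu + 1) * bcoef mu n) / (mu + 1 + INR n)); [field; lra |].
  rewrite <- e. field. lra.
Qed.

Lemma continuous_bseries (mu z : R) : -1 < mu -> continuous (bseries mu) z.
Proof.
intros hmu. apply (ex_derive_continuous (bseries mu)). eexists. now apply is_derive_bseries.
Qed.

(** This is [(z^(mu+1) bseries (mu+1) z)' = (mu + 1) z^mu bseries mu z] divided by [z^mu], with the
    derivative of [bseries (mu+1)] written out; coefficientwise it is [bcoef_lower]. *)
Lemma bseries_lower (mu z : R) : -1 < mu ->
  (mu + 1) * bseries (mu + 1) z - z * bseries (mu + 2) z / (mu + 2) = (mu + 1) * bseries mu z.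
Proof.
intros hmu.
assert (hd : PSeries (PS_derive (bcoef (mu + 1))) z = - bseries (mu + 2) z / (mu + 2)).
{ replace (mu + 2) with (mu + 1 + 1) by ring.
  rewrite <- (is_derive_unique _ _ _ (is_derive_bseries (mu + 1) z ltac:(lra))).
  symmetry. unfold bseries. apply Derive_PSeries. now rewrite CV_radius_bcoef by lra. }
replace ((mu + 1) * bseries (mu + 1) z - z * bseries (mu + 2) z / (mu + 2))
  with ((mu + 1) * PSeries (bcoef (mu + 1)) z + z * PSeries (PS_derive (bcoef (mu + 1))) z)
  by (rewrite hd; unfold bseries; field; lra).
unfold bseries. rewrite <- !(PSeries_scal (mu + 1)).
rewrite <- (PSeries_incr_1 (PS_derive (bcoef (mu + 1))) z).
rewrite <- PSeries_plus.
- apply PSeries_ext. intros [| n];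
    unfold PS_plus, PS_scal, PS_incr_1, PS_derive, plus, scal, zero; simpl; unfold mult; simpl.
  + unfold bcoef. simpl. field.
  + rewrite <- (bcoef_lower mu (S n) hmu).
    change (match n with O => 1 | S _ => INR n + 1 end) with (INR (S n)). ring.
- apply ex_pseries_scal; [apply Rmult_comm |].
  apply CV_radius_inside. now rewrite CV_radius_bcoef by lra.
- apply ex_pseries_incr_1. apply ex_pseries_derive. now rewrite CV_radius_bcoef by lra.
Qed.

Lemma Gamma_rising (s : R) (k : nat) : 0 < s -> Gamma (INR k + s) = rising s k * Gamma s.
Proof.
intros hs. induction k as [| k IH].
- simpl. rewrite Rplus_0_l. ring.
- assert (hk := pos_INR k).
  rewrite S_INR. replace (INR k + 1 + s) with (INR k + s + 1) by ring.
  rewrite Gamma_succ, IH by lra. simpl. ring.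
Qed.

Lemma BesselJ_bseries (mu x : R) : -1 < mu -> 0 < x ->
  BesselJ mu x = Rpower (x / 2) mu / Gamma (mu + 1) * bseries mu ((x / 2) ^ 2).
Proof.
intros hmu hx. unfold BesselJ, bseries, PSeries. rewrite <- Series_scal_l.
apply Series_ext. intros k.
rewrite Rplus_assoc, Gamma_rising, Rpower_plus by lra.
replace (2 * INR k) with (INR (2 * k)) by (rewrite mult_INR; reflexivity).
rewrite Rpower_pow, pow_mult by lra.
unfold bcoef.
assert (h := rising_pos (mu + 1) k ltac:(lra)).
assert (h' := INR_fact_lt_0 k). assert (hg := Gamma_pos (mu + 1) ltac:(lra)).
field. lra.
Qed.

(** * Eigenfunctions of the linear problem *)

Lemma nu_bounds (alpha : R) : 0 < alpha -> 0 < nu alpha < 1 / 2.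
Proof.
intros ha. unfold nu. split; [apply Rdiv_lt_0_compat; lra |].
apply Rmult_lt_compat_l; [lra |]. apply Rinv_lt_contravar; lra.
Qed.

Lemma is_derive_bseries_rpow (mu k b x : R) : -1 < mu -> 0 < x ->
  is_derive (fun t => bseries mu (k * rpow (Rabs t) b)) x
    (- (k * b * rpow (Rabs x) (b - 1) * bseries (mu + 1) (k * rpow (Rabs x) b)) / (mu + 1)).
Proof.
intros hmu hx.
replace (- (k * b * rpow (Rabs x) (b - 1) * bseries (mu + 1) (k * rpow (Rabs x) b)) / (mu + 1))
  with ((k * (b * rpow (Rabs x) (b - 1)))
        * (- bseries (mu + 1) (k * rpow (Rabs x) b) / (mu + 1))) by (field; lra).
apply (is_derive_comp (bseries mu) (fun t => k * rpow (Rabs t) b)).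
- now apply is_derive_bseries.
- apply (is_derive_scal (fun t => rpow (Rabs t) b)). now apply is_derive_rpow_abs.
Qed.

Lemma continuous_bseries_rpow (mu k b x : R) : -1 < mu -> 0 < b ->
  continuous (fun t => bseries mu (k * rpow (Rabs t) b)) x.
Proof.
intros hmu hb.
apply (continuous_comp (fun t => k * rpow (Rabs t) b) (bseries mu)).
- apply (continuous_scal_r k (fun t => rpow (Rabs t) b)). now apply continuous_rpow_abs.
- now apply continuous_bseries.
Qed.

(** In the variable [z = l x^(alpha+2) / (alpha+2)^2] the solutions of [- y'' = l x^alpha y] on the
    positive half-line are spanned by [bseries (- nu) z] and [x bseries nu z]. *)
Definition mode_arg (alpha l x : R) : R := l / (alpha + 2) ^ 2 * rpow (Rabs x) (alpha + 2).

Definition even_mode (alpha l x : R) : R := bseries (- nu alpha) (mode_arg alpha l x).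

(** The factor is written with [alpha + 1] because [(alpha + 2) (1 - nu) = alpha + 1]. *)
Definition even_mode' (alpha l x : R) : R :=
  - (l / (alpha + 1)) * (rpow (Rabs x) (alpha + 1) * bseries (1 - nu alpha) (mode_arg alpha l x)).

Definition odd_mode (alpha l x : R) : R := x * bseries (nu alpha) (mode_arg alpha l x).

(** Order [nu - 1] appears because [nu F + z F'] for the series [F] of order [nu] is [nu] times
    the series of order [nu - 1]. *)
Definition odd_mode' (alpha l x : R) : R := bseries (nu alpha - 1) (mode_arg alpha l x).

Lemma even_mode_0 (alpha l : R) : even_mode alpha l 0 = 1.
Proof. unfold even_mode, mode_arg. rewrite Rabs_R0, rpow_0, Rmult_0_r. apply bseries_0. Qed.

Lemma even_mode'_0 (alpha l : R) : even_mode' alpha l 0 = 0.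
Proof. unfold even_mode'. rewrite Rabs_R0, rpow_0. ring. Qed.

Lemma is_derive_even_mode (alpha l x : R) : 0 < alpha -> 0 < x ->
  is_derive (even_mode alpha l) x (even_mode' alpha l x).
Proof.
intros halpha hx. assert (hn := nu_bounds alpha halpha).
assert (h := is_derive_bseries_rpow (- nu alpha) (l / (alpha + 2) ^ 2) (alpha + 2) x ltac:(lra) hx).
unfold even_mode', mode_arg.
replace (- nu alpha + 1) with (1 - nu alpha) in h by ring.
replace (alpha + 2 - 1) with (alpha + 1) in h by ring.
set (r := rpow (Rabs x) (alpha + 1)) in *.
set (s := bseries (1 - nu alpha) _) in *.
replace (- (l / (alpha + 1)) * (r * s))
  with (- (l / (alpha + 2) ^ 2 * (alpha + 2) * r * s) / (1 - nu alpha)).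
- exact h.
- unfold nu. field. lra.
Qed.

Lemma is_derive_even_mode' (alpha l x : R) : 0 < alpha -> 0 < x ->
  is_derive (even_mode' alpha l) x (- l * rpow (Rabs x) alpha * even_mode alpha l x).
Proof.
intros halpha hx. assert (hn := nu_bounds alpha halpha).
unfold even_mode', even_mode, mode_arg.
set (k := l / (alpha + 2) ^ 2).
assert (h1 := is_derive_rpow_abs x (alpha + 1) hx).
replace (alpha + 1 - 1) with alpha in h1 by ring.
assert (h2 := is_derive_bseries_rpow (1 - nu alpha) k (alpha + 2) x ltac:(lra) hx).
replace (alpha + 2 - 1) with (alpha + 1) in h2 by ring.
assert (h3 := is_derive_mult _ _ _ _ _ h1 h2 Rmult_comm).
assert (h4 := is_derive_scal _ _ (- (l / (alpha + 1))) _ h3).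
assert (e := bseries_lower (- nu alpha) (k * rpow (Rabs x) (alpha + 2)) ltac:(lra)).
replace (- nu alpha + 1) with (1 - nu alpha) in e by ring.
replace (- nu alpha + 2) with (1 - nu alpha + 1) in e by ring.
assert (e1 : rpow (Rabs x) (alpha + 1) = x * rpow (Rabs x) alpha).
{ rewrite rpow_succ by apply Rabs_pos. rewrite (Rabs_pos_eq x); lra. }
assert (e2 : rpow (Rabs x) (alpha + 2) = x * (x * rpow (Rabs x) alpha)).
{ rewrite <- e1. replace (alpha + 2) with (alpha + 1 + 1) by ring.
  rewrite rpow_succ by apply Rabs_pos. now rewrite (Rabs_pos_eq x) by lra. }
set (z := k * rpow (Rabs x) (alpha + 2)) in *.
set (r := rpow (Rabs x) alpha) in *.
set (s0 := bseries (- nu alpha) z) in *.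
set (s1 := bseries (1 - nu alpha) z) in *.
set (s2 := bseries (1 - nu alpha + 1) z) in *.
replace (- l * r * s0) with
  (- (l / (alpha + 1)) * ((alpha + 1) * r * s1
    + rpow (Rabs x) (alpha + 1) * (- (k * (alpha + 2) * rpow (Rabs x) (alpha + 1) * s2) / (1 - nu alpha + 1)))).
- exact h4.
- rewrite e1.
  assert (e3 : z = k * (x * (x * r))) by (unfold z; now rewrite e2).
  assert (e4 : s0 = s1 - z * s2 / ((1 - nu alpha + 1) * (1 - nu alpha))).
  { apply (Rmult_eq_reg_l (1 - nu alpha)); [| lra]. rewrite <- e. field. lra. }
  rewrite e4, e3. unfold nu. field.
  lra.
Qed.

Lemma continuous_even_mode (alpha l x : R) : 0 < alpha -> continuous (even_mode alpha l) x.
Proof.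
intros ha. assert (hn := nu_bounds alpha ha). apply continuous_bseries_rpow; lra.
Qed.

Lemma continuous_even_mode' (alpha l x : R) : 0 < alpha -> continuous (even_mode' alpha l) x.
Proof.
intros ha. assert (hn := nu_bounds alpha ha).
apply (continuous_scal_r (- (l / (alpha + 1)))
  (fun x => rpow (Rabs x) (alpha + 1) * bseries (1 - nu alpha) (mode_arg alpha l x))).
apply (continuous_mult (fun x => rpow (Rabs x) (alpha + 1))
  (fun x => bseries (1 - nu alpha) (mode_arg alpha l x))).
- apply continuous_rpow_abs. lra.
- apply continuous_bseries_rpow; lra.
Qed.

Lemma is_derive_odd_mode (alpha l x : R) : 0 < alpha -> 0 < x ->
  is_derive (odd_mode alpha l) x (odd_mode' alpha l x).
Proof.
intros halpha hx. assert (hn := nu_bounds alpha halpha).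
unfold odd_mode', odd_mode, mode_arg.
set (k := l / (alpha + 2) ^ 2).
assert (h2 := is_derive_bseries_rpow (nu alpha) k (alpha + 2) x ltac:(lra) hx).
replace (alpha + 2 - 1) with (alpha + 1) in h2 by ring.
assert (h3 := is_derive_mult _ _ _ _ _ (is_derive_id x) h2 Rmult_comm).
assert (e := bseries_lower (nu alpha - 1) (k * rpow (Rabs x) (alpha + 2)) ltac:(lra)).
replace (nu alpha - 1 + 1) with (nu alpha) in e by ring.
replace (nu alpha - 1 + 2) with (nu alpha + 1) in e by ring.
assert (e1 : rpow (Rabs x) (alpha + 2) = x * rpow (Rabs x) (alpha + 1)).
{ replace (alpha + 2) with (alpha + 1 + 1) by ring.
  rewrite rpow_succ by apply Rabs_pos. now rewrite (Rabs_pos_eq x) by lra. }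
set (z := k * rpow (Rabs x) (alpha + 2)) in *.
set (r := rpow (Rabs x) (alpha + 1)) in *.
set (s0 := bseries (nu alpha - 1) z) in *.
set (s1 := bseries (nu alpha) z) in *.
set (s2 := bseries (nu alpha + 1) z) in *.
replace s0 with (plus (mult one s1) (mult x (- (k * (alpha + 2) * r * s2) / (nu alpha + 1)))).
- exact h3.
- unfold plus, mult, one; simpl.
  assert (e3 : z = k * (x * r)) by (unfold z; now rewrite e1).
  apply (Rmult_eq_reg_l (nu alpha)); [| lra]. rewrite <- e, e3. unfold nu. field.
  lra.
Qed.

Lemma is_derive_odd_mode' (alpha l x : R) : 0 < alpha -> 0 < x ->
  is_derive (odd_mode' alpha l) x (- l * rpow (Rabs x) alpha * odd_mode alpha l x).
Proof.
intros halpha hx. assert (hn := nu_bounds alpha halpha).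
unfold odd_mode', odd_mode, mode_arg.
set (k := l / (alpha + 2) ^ 2).
assert (h2 := is_derive_bseries_rpow (nu alpha - 1) k (alpha + 2) x ltac:(lra) hx).
replace (alpha + 2 - 1) with (alpha + 1) in h2 by ring.
replace (nu alpha - 1 + 1) with (nu alpha) in h2 by ring.
assert (e1 : rpow (Rabs x) (alpha + 1) = x * rpow (Rabs x) alpha).
{ rewrite rpow_succ by apply Rabs_pos. rewrite (Rabs_pos_eq x); lra. }
rewrite e1 in h2.
set (s := bseries (nu alpha) _) in *. set (r := rpow (Rabs x) alpha) in *.
replace (- l * r * (x * s)) with (- (k * (alpha + 2) * (x * r) * s) / nu alpha).
- exact h2.
- unfold k, nu. field. lra.
Qed.

Lemma continuous_odd_mode (alpha l x : R) : 0 < alpha -> continuous (odd_mode alpha l) x.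
Proof.
intros ha. assert (hn := nu_bounds alpha ha).
apply (continuous_mult (fun x => x) (fun x => bseries (nu alpha) (mode_arg alpha l x))).
- apply continuous_id.
- apply continuous_bseries_rpow; lra.
Qed.

Lemma continuous_odd_mode' (alpha l x : R) : 0 < alpha -> continuous (odd_mode' alpha l) x.
Proof.
intros ha. assert (hn := nu_bounds alpha ha). apply continuous_bseries_rpow; lra.
Qed.

(** Such a [y] would be concave and positive on a half-line, hence nondecreasing; then
    [y'' <= - l y(1)] beyond [1] and [y'] eventually becomes negative. *)
Lemma oscillation (y y' : R -> R) (alpha l : R) :
  0 <= alpha -> 0 < l ->
  (forall x, 0 < x -> is_derive y x (y' x)) ->
  (forall x, 0 < x -> is_derive y' x (- l * rpow (Rabs x) alpha * y x)) ->
  (forall x, 0 < x -> 0 < y x) -> False.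
Proof.
intros ha hl h1 h2 hy.
assert (c1 : forall x, 0 < x -> continuous y x).
{ intros x hx. apply (ex_derive_continuous y). eexists. now apply h1. }
assert (c2 : forall x, 0 < x -> continuous y' x).
{ intros x hx. apply (ex_derive_continuous y'). eexists. now apply h2. }
assert (hdec : forall a b, 0 < a -> a <= b -> y' b <= y' a).
{ intros a b h0 hab. apply (derive_nonpos_le y' (fun x => - l * rpow (Rabs x) alpha * y x) a b hab).
  - intros x hx. apply h2. lra.
  - intros x hx. apply c2. lra.
  - intros x hx. assert (q1 := hy x ltac:(lra)). assert (q2 := rpow_ge0 (Rabs x) alpha).
    assert (0 <= l * rpow (Rabs x) alpha * y x)
      by (repeat apply Rmult_le_pos; lra). lra. }
assert (hpos : forall a, 0 < a -> 0 <= y' a).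
{ intros a h0. destruct (Rle_dec 0 (y' a)) as [|n]; [assumption | exfalso].
  assert (hya := hy a h0).
  (* [b] is where the tangent at [a] meets the axis; the concave [y] lies below it. *)
  set (b := a + y a / (- y' a)).
  assert (hab : 0 < y a / (- y' a)) by (apply Rdiv_lt_0_compat; lra).
  destruct (mvt_open y y' a b) as [c [q1 q2]].
  - unfold b; lra.
  - intros; apply h1; lra.
  - intros; apply c1; lra.
  - assert (q3 : y' c <= y' a) by (apply hdec; lra).
    assert (q4 := hy b ltac:(unfold b; lra)).
    assert (q5 : y' a * (b - a) = - y a) by (unfold b; field; lra).
    assert (y' c * (b - a) <= y' a * (b - a)) by (apply Rmult_le_compat_r; unfold b; lra). lra. }
assert (hinc : forall x, 1 < x -> y 1 <= y x).
{ intros x hx. destruct (mvt_open y y' 1 x hx) as [c [q1 q2]].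
  - intros; apply h1; lra.
  - intros; apply c1; lra.
  - assert (q3 := hpos c ltac:(lra)). assert (0 <= y' c * (x - 1)) by (apply Rmult_le_pos; lra). lra. }
assert (hy1 := hy 1 Rlt_0_1). assert (hp1 := hpos 1 Rlt_0_1).
assert (hly : 0 < l * y 1) by now apply Rmult_lt_0_compat.
(* Long enough for [y'] to fall from [y' 1] to at most [-1]. *)
set (T := (y' 1 + 1) / (l * y 1)).
assert (hT : 0 < T) by (apply Rdiv_lt_0_compat; lra).
assert (eT : l * y 1 * T = y' 1 + 1) by (unfold T; field; split; lra).
destruct (mvt_open y' (fun x => - l * rpow (Rabs x) alpha * y x) 1 (1 + T)) as [c [q1 q2]].
- lra.
- intros; apply h2; lra.
- intros; apply c2; lra.
- assert (q3 := hpos (1 + T) ltac:(lra)). assert (q4 := hinc c ltac:(lra)).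
  assert (q5 : 1 <= rpow (Rabs c) alpha).
  { rewrite <- (rpow_1 alpha). apply rpow_le; [assumption |]. rewrite Rabs_pos_eq; lra. }
  replace (1 + T - 1) with T in q2 by ring.
  assert (q6 : y 1 <= rpow (Rabs c) alpha * y c) by nra.
  assert (q7 : l * y 1 * T <= l * (rpow (Rabs c) alpha * y c) * T).
  { apply Rmult_le_compat_r; [lra |]. apply Rmult_le_compat_l; lra. }
  lra.
Qed.

(** The infimum of the positive zeros is attained: it is [2 sqrt z] for the first zero [z] of the
    series, and before it the series keeps the sign of its value [1] at [0]. *)
Lemma bessel_zero1_spec (mu : R) : -1 < mu ->
  (exists z, 0 < z /\ bseries mu z <= 0) ->
  0 < bessel_zero1 mu /\ bseries mu ((bessel_zero1 mu / 2) ^ 2) = 0 /\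
  forall z, 0 <= z < (bessel_zero1 mu / 2) ^ 2 -> 0 < bseries mu z.
Proof.
intros hmu [z1 [hz1 hb1]].
destruct (first_zero (bseries mu) 0 z1) as [z [hz [ez hpos]]].
{ lra. } { intros; now apply continuous_bseries. } { rewrite bseries_0; lra. } { exact hb1. }
assert (hs : 0 < sqrt z) by (apply sqrt_lt_R0; lra).
assert (es : sqrt z ^ 2 = z) by (simpl; rewrite Rmult_1_r; apply sqrt_sqrt; lra).
assert (hfac : forall x, 0 < Rpower (x / 2) mu / Gamma (mu + 1)).
{ intros x. apply Rdiv_lt_0_compat; [apply exp_pos | apply Gamma_pos; lra]. }
assert (e : bessel_zero1 mu = 2 * sqrt z).
{ unfold bessel_zero1. rewrite (is_glb_Rbar_unique _ (Finite (2 * sqrt z))); [reflexivity |].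
  split.
  - intros x [hx hJ]. simpl. rewrite BesselJ_bseries in hJ by lra.
    specialize (hfac x).
    assert (h0 : bseries mu ((x / 2) ^ 2) = 0).
    { apply Rmult_integral in hJ. destruct hJ; lra. }
    destruct (Rlt_dec x (2 * sqrt z)) as [hlt | n]; [exfalso | lra].
    assert ((x / 2) ^ 2 < z) by (rewrite <- es; simpl; nra).
    assert (0 < bseries mu ((x / 2) ^ 2)) by (apply hpos; split; [apply pow2_ge_0 | assumption]). lra.
  - intros b hb. apply (hb (2 * sqrt z)). split; [lra |].
    rewrite BesselJ_bseries by lra.
    replace (2 * sqrt z / 2) with (sqrt z) by field. rewrite es, ez. ring. }
rewrite e. replace (2 * sqrt z / 2) with (sqrt z) by field. rewrite es.
repeat split; [lra | assumption | assumption].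
Qed.

Lemma mode_arg_gt0 (alpha l x : R) : 0 < alpha -> 0 < l -> 0 < x -> 0 < mode_arg alpha l x.
Proof.
intros ha hl hx. unfold mode_arg. apply Rmult_lt_0_compat.
- apply Rdiv_lt_0_compat; [assumption | apply pow_lt; lra].
- apply rpow_gt0. now apply Rabs_pos_lt, Rgt_not_eq.
Qed.

(** Without a zero, the corresponding mode would contradict [oscillation]. *)
Lemma bseries_has_zero (alpha mu : R) : 0 < alpha -> mu = - nu alpha \/ mu = nu alpha ->
  exists z, 0 < z /\ bseries mu z <= 0.
Proof.
intros ha hmu. apply Classical_Prop.NNPP. intros hn.
assert (hpos : forall z, 0 < z -> 0 < bseries mu z).
{ intros z hz. destruct (Rlt_dec 0 (bseries mu z)); [assumption |].
  exfalso. apply hn. exists z. split; lra. }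
destruct hmu as [-> | ->].
- apply (oscillation (even_mode alpha 1) (even_mode' alpha 1) alpha 1); try lra.
  + intros x hx. now apply is_derive_even_mode.
  + intros x hx. now apply is_derive_even_mode'.
  + intros x hx. apply hpos. apply mode_arg_gt0; lra.
- apply (oscillation (odd_mode alpha 1) (odd_mode' alpha 1) alpha 1); try lra.
  + intros x hx. now apply is_derive_odd_mode.
  + intros x hx. now apply is_derive_odd_mode'.
  + intros x hx. apply Rmult_lt_0_compat; [assumption |]. apply hpos. apply mode_arg_gt0; lra.
Qed.

(** The value of [l] for which the first zero of the mode of order [mu] falls on [x = 1]. *)
Definition eigenvalue (alpha mu : R) : R := ((alpha + 2) * (bessel_zero1 mu / 2)) ^ 2.

Lemma mode_arg_eigen (alpha mu x : R) : 0 < alpha ->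
  mode_arg alpha (eigenvalue alpha mu) x = (bessel_zero1 mu / 2) ^ 2 * rpow (Rabs x) (alpha + 2).
Proof. intros ha. unfold mode_arg, eigenvalue. field. lra. Qed.

Lemma bessel_mode_pos (alpha mu x : R) : 0 < alpha -> mu = - nu alpha \/ mu = nu alpha ->
  0 <= x < 1 -> 0 < bseries mu (mode_arg alpha (eigenvalue alpha mu) x).
Proof.
intros ha hmu hx. assert (hn := nu_bounds alpha ha).
destruct (bessel_zero1_spec mu) as [hj [_ hpos]].
{ lra. } { now apply (bseries_has_zero alpha). }
rewrite mode_arg_eigen by assumption. apply hpos.
assert (h := pow_lt (bessel_zero1 mu / 2) 2 ltac:(lra)).
rewrite Rabs_pos_eq by lra.
assert (h0 := rpow_ge0 x (alpha + 2)).
assert (h1 : rpow x (alpha + 2) <= x).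
{ replace (alpha + 2) with (alpha + 1 + 1) by ring. rewrite rpow_succ by lra.
  assert (h1 := rpow_le_1 x (alpha + 1) ltac:(lra) ltac:(lra)).
  assert (x * rpow x (alpha + 1) <= x * 1) by (apply Rmult_le_compat_l; lra). lra. }
nra.
Qed.

Lemma eigen_pos (alpha mu : R) : 0 < alpha -> mu = - nu alpha \/ mu = nu alpha ->
  0 < eigenvalue alpha mu.
Proof.
intros ha hmu. assert (hn := nu_bounds alpha ha).
destruct (bessel_zero1_spec mu) as [hj _].
{ lra. } { now apply (bseries_has_zero alpha). }
apply pow_lt, Rmult_lt_0_compat; lra.
Qed.

Lemma even_mode_1 (alpha : R) : 0 < alpha ->
  even_mode alpha (eigenvalue alpha (- nu alpha)) 1 = 0.
Proof.
intros ha. assert (hn := nu_bounds alpha ha).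
destruct (bessel_zero1_spec (- nu alpha)) as [_ [e _]].
{ lra. } { apply (bseries_has_zero alpha); [assumption | now left]. }
unfold even_mode. now rewrite mode_arg_eigen, Rabs_R1, rpow_1, Rmult_1_r.
Qed.

(** Both sides contain the series of order [1 - nu] at [(j / 2)^2]: the left one through
    [BesselJ (1 - nu) j], the right one through the derivative of the mode.  The remaining
    factors agree by [Gamma (2 - nu) = (1 - nu) Gamma (1 - nu)]. *)
Lemma D_even_mode' (alpha : R) : 0 < alpha ->
  D_ alpha = - 2 * even_mode' alpha (eigenvalue alpha (- nu alpha)) 1.
Proof.
intros ha. assert (hn := nu_bounds alpha ha).
destruct (bessel_zero1_spec (- nu alpha)) as [hj _].
{ lra. } { apply (bseries_has_zero alpha); [assumption | now left]. }
unfold D_, even_mode'. rewrite mode_arg_eigen, Rabs_R1, !rpow_1, Rmult_1_r, Rmult_1_l by assumption.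
rewrite BesselJ_bseries by lra.
replace (- nu alpha + 1) with (1 - nu alpha) by ring.
rewrite Gamma_succ by lra.
assert (hG := Gamma_pos (1 - nu alpha) ltac:(lra)).
unfold eigenvalue.
set (j := bessel_zero1 (- nu alpha)) in *.
set (s := bseries _ _).
assert (e1 : Rpower j (1 + nu alpha) = Rpower 2 (nu alpha) * 2 * Rpower (j / 2) (1 + nu alpha)).
{ replace j with (2 * (j / 2)) at 1 by field. rewrite <- Rpower_mult_distr by lra.
  rewrite (Rpower_plus 1 (nu alpha) 2), Rpower_1 by lra. ring. }
assert (e2 : Rpower 2 (- nu alpha) * Rpower 2 (nu alpha) = 1).
{ rewrite <- Rpower_plus, Rplus_opp_l. apply Rpower_O. lra. }
assert (e3 : Rpower (j / 2) (1 - nu alpha) * Rpower (j / 2) (1 + nu alpha) = (j / 2) ^ 2).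
{ rewrite <- Rpower_plus. replace (1 - nu alpha + (1 + nu alpha)) with (INR 2) by (simpl; ring).
  apply Rpower_pow. lra. }
rewrite e1.
transitivity ((alpha + 2) * (Rpower 2 (- nu alpha) * Rpower 2 (nu alpha)) * 2
   * (Rpower (j / 2) (1 - nu alpha) * Rpower (j / 2) (1 + nu alpha)) * s / (1 - nu alpha)).
{ field. lra. }
rewrite e2, e3. unfold nu. field. lra.
Qed.

(** * Classical solutions *)

(** Carries the derivative as a function and extends continuity to the whole line, which the
    mean value arguments use up to the end points. *)
Record classical_solution (alpha p : R) (u u' : R -> R) : Prop := {
  cs_cont : forall x, continuous u x;
  cs_deriv : forall x, -1 < x < 1 -> is_derive u x (u' x);
  cs_eq : forall x, -1 < x < 1 ->
    is_derive u' x (- (rpow (Rabs x) alpha * rpow (u x) (p - 1)));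
  cs_pos : forall x, -1 < x < 1 -> 0 < u x;
  cs_left : u (-1) = 0;
  cs_right : u 1 = 0 }.

(** Extending the solution by its boundary values outside [[-1, 1]] makes it continuous everywhere. *)
Lemma henon_solution_classical (alpha p : R) (v : R -> R) : henon_solution alpha p v ->
  exists u u', classical_solution alpha p u u' /\ forall x, -1 <= x <= 1 -> u x = v x.
Proof.
intros (hC2 & hc & heq & hpos & hl & hr).
assert (hloc : forall x, -1 < x < 1 -> locally x (fun t => -1 < t < 1)).
{ intros x hx. apply filter_and; [now apply open_gt | now apply open_lt]. }
exists (fun x => v (clamp x)), (Derive v). split; [split |].
- intros x. apply filterlim_locally. intros e.
  destruct (proj1 (filterlim_locally _ _) (hc (clamp x) (clamp_range x)) e) as [d hd].
  exists d. intros y hy. apply hd; [| apply clamp_range].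
  unfold ball in *; simpl in *; unfold AbsRing_ball, abs, minus, plus, opp in *; simpl in *.
  eapply Rle_lt_trans; [apply clamp_lipschitz | exact hy].
- intros x hx. apply (is_derive_ext_loc v).
  + apply (filter_imp (fun t => -1 < t < 1)); [| now apply hloc].
    intros t ht. now rewrite clamp_id by lra.
  + apply Derive_correct. apply (proj1 (hC2 x hx) 1%nat). auto.
- intros x hx. rewrite clamp_id by lra.
  replace (- (rpow (Rabs x) alpha * rpow (v x) (p - 1))) with (Derive_n v 2 x)
    by (rewrite <- heq by assumption; ring).
  apply (Derive_correct (Derive v)). exact (proj1 (hC2 x hx) 2%nat (le_n 2)).
- intros x hx. rewrite clamp_id by lra. now apply hpos.
- now rewrite clamp_id by lra.
- now rewrite clamp_id by lra.
- intros x hx. now rewrite clamp_id.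
Qed.

Lemma classical_henon_solution (alpha p : R) (u u' : R -> R) :
  0 < alpha -> 2 < p -> classical_solution alpha p u u' -> henon_solution alpha p u.
Proof.
intros ha hp [hc hd he hpos hl hr].
assert (hloc : forall x, -1 < x < 1 -> locally x (fun t => -1 < t < 1)).
{ intros x hx. apply filter_and; [now apply open_gt | now apply open_lt]. }
assert (hD1 : forall x, -1 < x < 1 -> locally x (fun t => u' t = Derive u t)).
{ intros x hx. apply (filter_imp (fun t => -1 < t < 1)); [| now apply hloc].
  intros t ht. symmetry. apply is_derive_unique. now apply hd. }
assert (hD2 : forall x, -1 < x < 1 ->
  is_derive (Derive u) x (- (rpow (Rabs x) alpha * rpow (u x) (p - 1)))).
{ intros x hx. apply (is_derive_ext_loc u'); [now apply hD1 | now apply he]. }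
assert (hD2' : forall x, -1 < x < 1 ->
  Derive_n u 2 x = - (rpow (Rabs x) alpha * rpow (u x) (p - 1))).
{ intros x hx. apply is_derive_unique. now apply hD2. }
split; [| split; [| split; [| split; [| split]]]].
- intros x hx. split.
  + intros k hk. destruct k as [| [| [| k]]]; [exact I | | | lia].
    * eexists. now apply hd.
    * eexists. now apply hD2.
  + apply (continuous_ext_loc _ (fun t => -1 * (rpow (Rabs t) alpha * rpow (Rabs (u t)) (p - 1)))).
    * apply (filter_imp (fun t => -1 < t < 1)); [| now apply hloc].
      intros t ht. rewrite hD2' by assumption.
      rewrite (Rabs_pos_eq (u t)) by (left; now apply hpos). simpl. ring.
    * apply continuous_Rmult; [apply continuous_const |].
      apply continuous_Rmult; [now apply continuous_rpow_abs |].
      apply (continuous_comp u (fun y => rpow (Rabs y) (p - 1))); [apply hc |].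
      apply continuous_rpow_abs. lra.
- intros x _. apply filterlim_filter_le_1 with (2 := hc x).
  intros P hP. unfold within. now apply (filter_imp P).
- intros x hx. rewrite hD2' by assumption. ring.
- exact hpos.
- exact hl.
- exact hr.
Qed.

Lemma classical_solution_reflect (alpha p : R) (u u' : R -> R) :
  classical_solution alpha p u u' ->
  classical_solution alpha p (fun x => u (- x)) (fun x => - u' (- x)).
Proof.
intros [hc hd he hpos hl hr]. split.
- intros x. now apply continuous_neg_arg.
- intros x hx. apply is_derive_neg_arg, hd. lra.
- intros x hx. rewrite <- (Rabs_Ropp x).
  apply (is_derive_opp (fun t => u' (- t))).
  replace (rpow (Rabs (- x)) alpha * rpow (u (- x)) (p - 1))
    with (- - (rpow (Rabs (- x)) alpha * rpow (u (- x)) (p - 1))) by ring.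
  apply is_derive_neg_arg, he. lra.
- intros x hx. apply hpos. lra.
- replace (- -1) with 1 by ring. exact hr.
- replace (- (1)) with (-1) by ring. exact hl.
Qed.

Definition even_sum (u : R -> R) (x : R) : R := u x + u (- x).
Definition even_sum' (u' : R -> R) (x : R) : R := u' x - u' (- x).

Lemma even_sum_deriv (alpha p : R) (u u' : R -> R) (x : R) :
  classical_solution alpha p u u' -> -1 < x < 1 ->
  is_derive (even_sum u) x (even_sum' u' x) /\
  is_derive (even_sum' u') x
    (- (rpow (Rabs x) alpha * (rpow (u x) (p - 1) + rpow (u (- x)) (p - 1)))).
Proof.
intros hu hx. assert (hr := classical_solution_reflect _ _ _ _ hu). split.
- apply (is_derive_plus u (fun t => u (- t)));
    [now apply (cs_deriv _ _ _ _ hu) | now apply (cs_deriv _ _ _ _ hr)].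
- replace (- (rpow (Rabs x) alpha * (rpow (u x) (p - 1) + rpow (u (- x)) (p - 1))))
    with (- (rpow (Rabs x) alpha * rpow (u x) (p - 1))
          + - (rpow (Rabs x) alpha * rpow (u (- x)) (p - 1))) by ring.
  apply (is_derive_plus u' (fun t => - u' (- t)));
    [now apply (cs_eq _ _ _ _ hu) | now apply (cs_eq _ _ _ _ hr)].
Qed.

(** The lower bound is the chord of the concave function [even_sum u] from [0] to [1]; the upper
    bound holds because its derivative vanishes at [0]. *)
Lemma even_sum_bounds (alpha p : R) (u u' : R -> R) (x : R) :
  classical_solution alpha p u u' -> 0 <= x <= 1 ->
  (1 - x) * (2 * u 0) <= even_sum u x <= 2 * u 0.
Proof.
intros hu hx.
assert (e0 : even_sum u 0 = 2 * u 0) by (unfold even_sum; rewrite Ropp_0; ring).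
assert (e1 : even_sum u 1 = 0).
{ unfold even_sum. replace (- (1)) with (-1) by ring.
  rewrite (cs_left _ _ _ _ hu), (cs_right _ _ _ _ hu). ring. }
assert (hc : forall t, continuous (even_sum u) t).
{ intros t. apply continuous_Rplus; [apply (cs_cont _ _ _ _ hu) |].
  apply continuous_neg_arg, (cs_cont _ _ _ _ hu). }
assert (hc' : forall t, -1 < t < 1 -> continuous (even_sum' u') t).
{ intros t ht. apply (ex_derive_continuous (even_sum' u')). eexists.
  now apply (even_sum_deriv alpha p u). }
assert (hm : forall a b, -1 < a -> a <= b -> b < 1 -> even_sum' u' b <= even_sum' u' a).
{ intros a b h1 h2 h3.
  apply (derive_nonpos_le _ (fun t => - (rpow (Rabs t) alpha * (rpow (u t) (p - 1) + rpow (u (- t)) (p - 1)))) a b h2).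
  - intros t ht. apply (even_sum_deriv alpha p u u'); [assumption | lra].
  - intros t ht. apply hc'. lra.
  - intros t _. assert (q1 := rpow_ge0 (Rabs t) alpha).
    assert (q2 := rpow_ge0 (u t) (p - 1)). assert (q3 := rpow_ge0 (u (- t)) (p - 1)). nra. }
assert (e'0 : even_sum' u' 0 = 0) by (unfold even_sum'; rewrite Ropp_0; ring).
split.
- assert (h := concave_above_chord (even_sum u) (even_sum' u') 0 1).
  rewrite e0, e1 in h.
  assert (h' := fun a b c => h a b c x hx). clear h.
  enough (2 * u 0 * (1 - x) + 0 * (x - 0) <= even_sum u x * (1 - 0)) by lra.
  apply h'.
  + intros t ht. apply (even_sum_deriv alpha p u u'); [assumption | lra].
  + intros t _. apply hc.
  + intros a b h1 h2 h3. apply hm; lra.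
- rewrite <- e0. apply (derive_nonpos_le (even_sum u) (even_sum' u') 0 x); [lra | | |].
  + intros t ht. apply (even_sum_deriv alpha p u u'); [assumption | lra].
  + intros t _. apply hc.
  + intros t ht. rewrite <- e'0. apply hm; lra.
Qed.

Lemma solution_lt (alpha p : R) (u u' : R -> R) (x : R) :
  classical_solution alpha p u u' -> -1 < x < 1 -> u x < 2 * u 0.
Proof.
intros hu hx.
assert (h : even_sum u x <= 2 * u 0).
{ destruct (Rle_dec 0 x).
  - apply (even_sum_bounds alpha p u u'); [assumption | lra].
  - replace (even_sum u x) with (even_sum u (- x))
      by (unfold even_sum; rewrite Ropp_involutive; ring).
    apply (even_sum_bounds alpha p u u'); [assumption | lra]. }
assert (0 < u (- x)) by (apply (cs_pos _ _ _ _ hu); lra).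
unfold even_sum in h. lra.
Qed.

Lemma even_mode_pos (alpha x : R) : 0 < alpha -> 0 <= x < 1 ->
  0 < even_mode alpha (eigenvalue alpha (- nu alpha)) x.
Proof. intros ha hx. apply bessel_mode_pos; [assumption | now left | assumption]. Qed.

Lemma even_mode'_1_nonpos (alpha : R) : 0 < alpha ->
  even_mode' alpha (eigenvalue alpha (- nu alpha)) 1 <= 0.
Proof.
intros ha. assert (hl := eigen_pos alpha (- nu alpha) ha (or_introl eq_refl)).
set (l := eigenvalue alpha (- nu alpha)) in *.
rewrite <- (even_mode'_0 alpha l).
apply (derive_nonpos_le (even_mode' alpha l) (fun x => - l * rpow (Rabs x) alpha * even_mode alpha l x)); [lra | | |].
- intros x hx. apply is_derive_even_mode'; lra.
- intros x _. now apply continuous_even_mode'.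
- intros x hx. assert (q1 := even_mode_pos alpha x ha ltac:(lra)). fold l in q1.
  assert (q2 := rpow_ge0 (Rabs x) alpha).
  assert (0 <= l * rpow (Rabs x) alpha * even_mode alpha l x) by (apply Rmult_le_pos; [apply Rmult_le_pos |]; lra).
  lra.
Qed.

(** [sub_rpow_le_c] at [t = y / M], multiplied by [M ^ (p - 1)]. *)
Lemma power_deficit (p M y : R) : 2 < p -> 0 < M -> 0 < y ->
  Rpower M (p - 2) * y - M * Rpower M (p - 2) * c_ p <= rpow y (p - 1).
Proof.
intros hp hM hy.
assert (hL : 0 < Rpower M (p - 2)) by apply exp_pos.
assert (hq : 0 < y / M) by now apply Rdiv_lt_0_compat.
assert (h := sub_rpow_le_c p (y / M) hp hq).
assert (e : rpow y (p - 1) = M * Rpower M (p - 2) * rpow (y / M) (p - 1)).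
{ replace y with (M * (y / M)) at 1 by (field; lra).
  rewrite rpow_mult_distr by lra. f_equal.
  replace (p - 1) with (p - 2 + 1) by ring.
  now rewrite rpow_succ, rpow_pos by lra. }
rewrite e.
assert (h' : M * Rpower M (p - 2) * (y / M - rpow (y / M) (p - 1)) <= M * Rpower M (p - 2) * c_ p).
{ apply Rmult_le_compat_l; [nra | exact h]. }
assert (e' : M * Rpower M (p - 2) * (y / M) = Rpower M (p - 2) * y) by (field; lra).
lra.
Qed.

(** Sturm-type identity in differential form.  [Q] below is made of antiderivatives of the two
    bounds used for [u^(p-1)] and [even_sum u], so that the Wronskian of [even_sum u] and [phi]
    plus [Q] is nonincreasing; comparing its values at [0] and [1] gives the inequality. *)
Lemma amplitude_bound (alpha p : R) (u u' : R -> R) :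
  0 < alpha -> 2 < p -> classical_solution alpha p u u' ->
  let L := Rpower (2 * u 0) (p - 2) in
  let l := eigenvalue alpha (- nu alpha) in
  l <= L -> L - l <= L * (c_ p * D_ alpha).
Proof.
intros ha hp hu L l hlL.
assert (hl : 0 < l) by (apply eigen_pos; [assumption | now left]).
assert (hu0 : 0 < u 0) by (apply (cs_pos _ _ _ _ hu); lra).
set (M := 2 * u 0) in *.
assert (hM : 0 < M) by (unfold M; lra).
assert (hL : 0 < L) by apply exp_pos.
rewrite D_even_mode' by assumption. fold l.
set (phi := even_mode alpha l). set (phi' := even_mode' alpha l).
set (e := even_sum u). set (e' := even_sum' u').
set (c := c_ p). set (k := (L - l) * M / l).
assert (hk : 0 <= k) by (apply Rmult_le_pos; [nra | left; now apply Rinv_0_lt_compat]).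
set (Q := fun x => 2 * M * L * c / l * phi' x - k * (phi' x * (1 - x) + phi x)).
set (N := fun x => e' x * phi x - e x * phi' x + Q x).
assert (hcphi : forall x, continuous phi x) by (intros; now apply continuous_even_mode).
assert (hcphi' : forall x, continuous phi' x) by (intros; now apply continuous_even_mode').
assert (hce : forall x, continuous e x).
{ intros t. apply continuous_Rplus; [apply (cs_cont _ _ _ _ hu) |].
  apply continuous_neg_arg, (cs_cont _ _ _ _ hu). }
assert (hce' : forall t, -1 < t < 1 -> continuous e' t).
{ intros t ht. apply (ex_derive_continuous e'). eexists. now apply (even_sum_deriv alpha p u). }
assert (hcQ : forall x, continuous Q x).
{ intros x. unfold Q.
  apply continuous_Rminus; [apply continuous_Rmult; [apply continuous_const | apply hcphi'] |].
  apply continuous_Rmult; [apply continuous_const |].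
  apply continuous_Rplus; [| apply hcphi].
  apply continuous_Rmult; [apply hcphi' |].
  apply continuous_Rminus; [apply continuous_const | apply continuous_id]. }
assert (hdphi : forall x, 0 < x -> is_derive phi x (phi' x)) by (intros; now apply is_derive_even_mode).
assert (hdphi' : forall x, 0 < x -> is_derive phi' x (- l * rpow (Rabs x) alpha * phi x))
  by (intros; now apply is_derive_even_mode').
set (e2 := fun x => - (rpow (Rabs x) alpha * (rpow (u x) (p - 1) + rpow (u (- x)) (p - 1)))).
assert (hde : forall x, -1 < x < 1 -> is_derive e x (e' x) /\ is_derive e' x (e2 x)).
{ intros x hx. now apply (even_sum_deriv alpha p u u'). }
set (N' := fun x => (e2 x * phi x - e x * (- l * rpow (Rabs x) alpha * phi x))
   + (2 * M * L * c / l * (- l * rpow (Rabs x) alpha * phi x)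
      - k * (- l * rpow (Rabs x) alpha * phi x * (1 - x)))).
assert (hdN : forall x, 0 < x < 1 -> is_derive N x (N' x)).
{ intros x hx. destruct (hde x ltac:(lra)) as [h1 h2].
  assert (h3 := hdphi x ltac:(lra)). assert (h4 := hdphi' x ltac:(lra)).
  apply (is_derive_plus (fun t => e' t * phi t - e t * phi' t) Q).
  - now apply is_derive_wronskian.
  - apply (is_derive_minus (fun t => 2 * M * L * c / l * phi' t)
      (fun t => k * (phi' t * (1 - t) + phi t))).
    + now apply is_derive_scal.
    + apply (is_derive_scal (fun t => phi' t * (1 - t) + phi t)).
      replace (- l * rpow (Rabs x) alpha * phi x * (1 - x))
        with ((- l * rpow (Rabs x) alpha * phi x * (1 - x) + phi' x * (-1)) + phi' x) by ring.
      apply (is_derive_plus (fun t => phi' t * (1 - t)) phi); [| assumption].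
      apply (is_derive_mult phi' (fun t => 1 - t)); [assumption | | intros; apply Rmult_comm].
      auto_derive; [trivial | ring]. }
assert (hN' : forall x, 0 < x < 1 -> N' x <= 0).
{ intros x hx. unfold N', e2.
  assert (hpx := even_mode_pos alpha x ha ltac:(lra)). fold l phi in hpx.
  assert (q := rpow_ge0 (Rabs x) alpha).
  assert (h1 := power_deficit p M (u x) hp hM ltac:(apply (cs_pos _ _ _ _ hu); lra)).
  assert (h2 := power_deficit p M (u (- x)) hp hM ltac:(apply (cs_pos _ _ _ _ hu); lra)).
  fold L c in h1, h2.
  assert (h3 : (1 - x) * M <= e x) by (apply (even_sum_bounds alpha p u u'); [assumption | lra]).
  assert (ee : e x = u x + u (- x)) by reflexivity.
  set (r := rpow (Rabs x) alpha) in *.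
  set (U := rpow (u x) (p - 1)) in *. set (V := rpow (u (- x)) (p - 1)) in *.
  replace (- (r * (U + V)) * phi x - e x * (- l * r * phi x)
     + (2 * M * L * c / l * (- l * r * phi x) - k * (- l * r * phi x * (1 - x))))
    with (- (r * phi x) * ((U + V) - l * e x + 2 * M * L * c - (L - l) * M * (1 - x)))
    by (unfold k; field; lra).
  assert (0 <= (L - l) * (e x - (1 - x) * M)) by (apply Rmult_le_pos; lra).
  assert (0 <= (U + V) - l * e x + 2 * M * L * c - (L - l) * M * (1 - x)) by nra.
  assert (0 <= r * phi x) by (apply Rmult_le_pos; lra). nra. }
assert (hN0 : N 0 = - k).
{ unfold N, Q, e', even_sum', phi, phi'. rewrite Ropp_0, even_mode_0, even_mode'_0. ring. }
assert (hNle : forall x, 0 <= x < 1 -> N x <= - k).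
{ intros x hx. rewrite <- hN0. apply (derive_nonpos_le N N' 0 x); [lra | | |].
  - intros t ht. apply hdN. lra.
  - intros t ht. apply continuous_Rplus; [| apply hcQ].
    apply continuous_Rminus; apply continuous_Rmult; auto. apply hce'. lra.
  - intros t ht. apply hN'. lra. }
(* Near [1] the sign of [e'] is unfavourable, but [e'' >= - B] keeps [e'] bounded, and
   multiplied by [phi], which vanishes at [1], it has no effect in the limit. *)
set (B := 2 * rpow M (p - 1)).
assert (he'lo : forall x, 0 < x < 1 -> - B <= e' x).
{ intros x hx. destruct (mvt_open e' e2 0 x) as [t [h1 h2]]; [lra | | |].
  - intros t ht. apply hde. lra.
  - intros t ht. apply hce'. lra.
  - replace (e' 0) with 0 in h2 by (unfold e', even_sum'; rewrite Ropp_0; ring).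
    assert (q1 : rpow (u t) (p - 1) <= rpow M (p - 1)).
    { apply rpow_le; [lra |]. split.
      - left. apply (cs_pos _ _ _ _ hu). lra.
      - left. apply (solution_lt alpha p u u'); [assumption | lra]. }
    assert (q2 : rpow (u (- t)) (p - 1) <= rpow M (p - 1)).
    { apply rpow_le; [lra |]. split.
      - left. apply (cs_pos _ _ _ _ hu). lra.
      - left. apply (solution_lt alpha p u u'); [assumption | lra]. }
    assert (q3 : rpow (Rabs t) alpha <= 1).
    { apply rpow_le_1; [lra |]. rewrite Rabs_pos_eq; lra. }
    assert (q4 := rpow_ge0 (Rabs t) alpha).
    assert (q5 := rpow_ge0 (u t) (p - 1)). assert (q6 := rpow_ge0 (u (- t)) (p - 1)).
    assert (q7 : - B <= e2 t).
    { unfold e2, B. nra. }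
    assert (q8 : e2 t <= 0) by (unfold e2; nra).
    nra. }
assert (hend : - B * phi 1 - e 1 * phi' 1 + Q 1 <= - k).
{ apply (le_at_right_end (fun x => - B * phi x - e x * phi' x + Q x) 0 1); [lra | |].
  - apply continuous_Rplus; [| apply hcQ].
    apply continuous_Rminus; apply continuous_Rmult; auto. apply continuous_const.
  - intros x hx. eapply Rle_trans; [| apply (hNle x); lra].
    unfold N. assert (hpx := even_mode_pos alpha x ha ltac:(lra)). fold l phi in hpx.
    specialize (he'lo x hx).
    assert (- B * phi x <= e' x * phi x) by (apply Rmult_le_compat_r; lra). lra. }
assert (p1 : phi 1 = 0) by now apply even_mode_1.
assert (ee1 : e 1 = 0).
{ unfold e, even_sum. replace (- (1)) with (-1) by ring.
  rewrite (cs_left _ _ _ _ hu), (cs_right _ _ _ _ hu). ring. }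
unfold Q in hend. rewrite p1, ee1 in hend.
apply (Rmult_le_reg_l (M / l)); [now apply Rdiv_lt_0_compat |].
replace (M / l * (L - l)) with k by (unfold k; field; lra).
replace (M / l * (L * (c * (-2 * phi' 1)))) with (- (2 * M * L * c / l * phi' 1)) by (field; lra).
lra.
Qed.

(** * Symmetry and uniqueness *)

(** By the amplitude bound [L (1 - c_p D) <= l1], and the hypothesis says
    [(p - 1) l1 / l2 <= 1 - c_p D]. *)
Lemma spectral_gap (alpha p : R) (u u' : R -> R) :
  0 < alpha -> 2 < p ->
  (p - 1) * (bessel_zero1 (- nu alpha) / bessel_zero1 (nu alpha)) ^ 2 + c_ p * D_ alpha <= 1 ->
  classical_solution alpha p u u' ->
  (p - 1) * Rpower (2 * u 0) (p - 2) <= eigenvalue alpha (nu alpha).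
Proof.
intros ha hp hcond hu. assert (hn := nu_bounds alpha ha).
assert (hl1 := eigen_pos alpha (- nu alpha) ha (or_introl eq_refl)).
assert (hl2 := eigen_pos alpha (nu alpha) ha (or_intror eq_refl)).
assert (hj2 : 0 < bessel_zero1 (nu alpha)).
{ apply bessel_zero1_spec; [lra |]. apply (bseries_has_zero alpha); [assumption | now right]. }
replace ((bessel_zero1 (- nu alpha) / bessel_zero1 (nu alpha)) ^ 2)
  with (eigenvalue alpha (- nu alpha) / eigenvalue alpha (nu alpha)) in hcond
  by (unfold eigenvalue; field; lra).
assert (hb := amplitude_bound alpha p u u' ha hp hu). cbv zeta in hb.
assert (hc : 0 <= c_ p).
{ assert (h := sub_rpow_le_c p 1 hp Rlt_0_1). rewrite rpow_1 in h. lra. }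
assert (hD : 0 <= D_ alpha).
{ rewrite D_even_mode' by assumption. assert (h := even_mode'_1_nonpos alpha ha). lra. }
assert (hL : 0 < Rpower (2 * u 0) (p - 2)) by apply exp_pos.
set (L := Rpower (2 * u 0) (p - 2)) in *.
set (l1 := eigenvalue alpha (- nu alpha)) in *. set (l2 := eigenvalue alpha (nu alpha)) in *.
assert (hcD : 0 <= c_ p * D_ alpha) by now apply Rmult_le_pos.
set (d := c_ p * D_ alpha) in *.
assert (h1 : L * (1 - d) <= l1).
{ destruct (Rle_dec l1 L) as [h | h]; [specialize (hb h); lra | nra]. }
assert (h2 : L * ((p - 1) * (l1 / l2)) <= l1).
{ eapply Rle_trans; [| exact h1]. apply Rmult_le_compat_l; lra. }
apply (Rmult_le_reg_l (l1 / l2)); [now apply Rdiv_lt_0_compat |].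
replace (l1 / l2 * l2) with l1 by (field; lra). lra.
Qed.

(** If [w(x) = u(x) - u(-x)] had positive slope at [0], the Wronskian of [w] and the odd mode would
    increase from [0] as long as [w > 0].  At the first zero of [w] it would have to be
    nonpositive. *)
Lemma slope_at_0_not_pos (alpha p : R) (u u' : R -> R) :
  0 < alpha -> 2 < p -> classical_solution alpha p u u' ->
  (p - 1) * Rpower (2 * u 0) (p - 2) <= eigenvalue alpha (nu alpha) ->
  ~ 0 < u' 0.
Proof.
intros ha hp hu hgap hslope. assert (hn := nu_bounds alpha ha).
set (l := eigenvalue alpha (nu alpha)) in *.
assert (hr := classical_solution_reflect _ _ _ _ hu).
set (w := fun x => u x - u (- x)). set (w' := fun x => u' x - - u' (- x)).
set (r := fun x => rpow (Rabs x) alpha).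
set (w2 := fun x => - (r x * rpow (u x) (p - 1)) - - (r x * rpow (u (- x)) (p - 1))).
assert (hdw : forall x, -1 < x < 1 -> is_derive w x (w' x) /\ is_derive w' x (w2 x)).
{ intros x hx. split.
  - apply (is_derive_minus u (fun t => u (- t)));
      [now apply (cs_deriv _ _ _ _ hu) | now apply (cs_deriv _ _ _ _ hr)].
  - apply (is_derive_minus u' (fun t => - u' (- t)));
      [now apply (cs_eq _ _ _ _ hu) | now apply (cs_eq _ _ _ _ hr)]. }
assert (hcw : forall x, continuous w x).
{ intros x. apply continuous_Rminus; [apply (cs_cont _ _ _ _ hu) | apply (cs_cont _ _ _ _ hr)]. }
assert (hcw' : forall x, -1 < x < 1 -> continuous w' x).
{ intros x hx. apply (ex_derive_continuous w'). eexists. now apply hdw. }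
assert (hw0 : w 0 = 0) by (unfold w; rewrite Ropp_0; ring).
assert (hw1 : w 1 = 0).
{ unfold w. replace (- (1)) with (-1) by ring.
  rewrite (cs_left _ _ _ _ hu), (cs_right _ _ _ _ hu). ring. }
assert (hpos0 : exists a, 0 < a < 1 /\ forall x, 0 < x <= a -> 0 < w x).
{ assert (hl : locally 0 (fun y => 0 < w' y)).
  { apply (hcw' 0 ltac:(lra) (fun y => 0 < y)). apply open_gt.
    unfold w'. rewrite Ropp_0. lra. }
  destruct (locally_Rabs _ _ hl) as [d [hd0 hd]].
  exists (Rmin (1 / 2) (d / 2)).
  assert (q1 := Rmin_l (1 / 2) (d / 2)). assert (q2 := Rmin_r (1 / 2) (d / 2)).
  assert (q3 : 0 < Rmin (1 / 2) (d / 2)) by (apply Rmin_pos; lra).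
  split; [lra |]. intros x hx. rewrite <- hw0.
  apply (derive_pos_lt w w' 0 x); [lra | | |].
  - intros t ht. apply hdw. lra.
  - intros t ht. apply hcw.
  - intros t ht. apply hd, Rabs_def1; lra. }
destruct hpos0 as [a [ha1 hapos]].
destruct (first_zero w a 1) as [b [hb [hwb hbpos]]]; [lra | intros; apply hcw | apply hapos; lra | lra |].
assert (hpos : forall x, 0 < x < b -> 0 < w x).
{ intros x hx. destruct (Rle_dec x a); [apply hapos | apply hbpos]; lra. }
set (psi := odd_mode alpha l). set (psi' := odd_mode' alpha l).
assert (hcpsi : forall x, continuous psi x) by (intros; now apply continuous_odd_mode).
assert (hcpsi' : forall x, continuous psi' x) by (intros; now apply continuous_odd_mode').
assert (hpsi : forall x, 0 < x < 1 -> 0 < psi x).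
{ intros x hx. apply Rmult_lt_0_compat; [lra |]. apply bessel_mode_pos; [assumption | now right | lra]. }
set (W := fun x => w' x * psi x - w x * psi' x).
set (W' := fun x => w2 x * psi x - w x * (- l * r x * psi x)).
assert (hdW : forall x, 0 < x < 1 -> is_derive W x (W' x)).
{ intros x hx. destruct (hdw x ltac:(lra)). apply is_derive_wronskian; [assumption | assumption | |].
  - apply is_derive_odd_mode; lra.
  - apply is_derive_odd_mode'; lra. }
assert (hcW : forall x, -1 < x < 1 -> continuous W x).
{ intros x hx. apply continuous_Rminus; apply continuous_Rmult; auto. }
assert (hW' : forall x, 0 < x < b -> 0 < W' x).
{ intros x hx. unfold W', w2.
  assert (q1 := hpsi x ltac:(lra)). assert (q2 := hpos x hx).
  assert (q3 : 0 < r x) by (apply rpow_gt0, Rabs_pos_lt; lra).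
  assert (q4 := solution_lt alpha p u u' x hu ltac:(lra)).
  assert (q5 : 0 < u (- x)) by (apply (cs_pos _ _ _ _ hu); lra).
  unfold w in q2.
  assert (q6 := rpow_diff_lt (u (- x)) (u x) (2 * u 0) (p - 1) ltac:(lra) q5 ltac:(lra) ltac:(lra)).
  replace (p - 1 - 1) with (p - 2) in q6 by ring.
  assert (q7 : (p - 1) * Rpower (2 * u 0) (p - 2) * (u x - u (- x)) <= l * (u x - u (- x)))
    by (apply Rmult_le_compat_r; lra).
  replace ((- (r x * rpow (u x) (p - 1)) - - (r x * rpow (u (- x)) (p - 1))) * psi x
    - w x * (- l * r x * psi x))
    with (r x * psi x * (l * (u x - u (- x)) - (rpow (u x) (p - 1) - rpow (u (- x)) (p - 1))))
    by (unfold w; ring).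
  apply Rmult_lt_0_compat; [now apply Rmult_lt_0_compat | lra]. }
assert (hWinc : forall x y, 0 <= x -> x < y -> y < b -> W x < W y).
{ intros x y h1 h2 h3. apply (derive_pos_lt W W' x y h2).
  - intros t ht. apply hdW. lra.
  - intros t ht. apply hcW. lra.
  - intros t ht. apply hW'. lra. }
assert (hW0 : W 0 = 0).
{ unfold W. rewrite hw0. unfold psi, odd_mode. ring. }
assert (hm := hWinc 0 (b / 2) ltac:(lra) ltac:(lra) ltac:(lra)). rewrite hW0 in hm.
assert (hl : locally b (fun y => - (w y * psi' y) < W (b / 2))).
{ assert (hc : continuous (fun y => -1 * (w y * psi' y)) b).
  { apply continuous_Rmult; [apply continuous_const |]. apply continuous_Rmult; auto. }
  assert (hl : locally b (fun y => -1 * (w y * psi' y) < W (b / 2))).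
  { apply (hc (fun y => y < W (b / 2))). apply open_lt. rewrite hwb. lra. }
  revert hl. apply filter_imp. intros y hy. lra. }
destruct (locally_Rabs _ _ hl) as [d [hd0 hd]].
(* [w] need not be differentiable at [b] when [b = 1], so the sign of the Wronskian is read at
   points [c] close to [b] with [w' c < 0], supplied by the mean value theorem on [[x, b]]. *)
set (x := Rmax (b / 2) (b - d / 2)).
assert (x < b) by (apply Rmax_lub_lt; lra).
assert (b / 2 <= x) by apply Rmax_l.
assert (b - d / 2 <= x) by apply Rmax_r.
destruct (mvt_open w w' x b) as [c [hc1 hc2]]; [lra | | |].
- intros t ht. apply hdw. lra.
- intros t ht. apply hcw.
- assert (q1 := hpos x ltac:(lra)). rewrite hwb in hc2.
  assert (q2 : w' c < 0) by nra.
  assert (q3 := hpsi c ltac:(lra)).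
  assert (q4 := hWinc (b / 2) c ltac:(lra) ltac:(lra) ltac:(lra)).
  assert (q5 : - (w c * psi' c) < W (b / 2)).
  { apply hd, Rabs_def1; lra. }
  unfold W at 2 in q4. nra.
Qed.

Lemma nonlinearity_lipschitz (alpha p M a b x : R) : 0 <= alpha -> 2 < p -> 0 < M ->
  0 <= x <= 1 -> 0 <= a <= M -> 0 <= b <= M ->
  Rabs (- (rpow (Rabs x) alpha * rpow a (p - 1)) - - (rpow (Rabs x) alpha * rpow b (p - 1)))
  <= (p - 1) * Rpower M (p - 2) * Rabs (a - b).
Proof.
intros ha hp hM hx h1 h2.
replace (- (rpow (Rabs x) alpha * rpow a (p - 1)) - - (rpow (Rabs x) alpha * rpow b (p - 1)))
  with (- (rpow (Rabs x) alpha * (rpow a (p - 1) - rpow b (p - 1)))) by ring.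
rewrite Rabs_Ropp, Rabs_mult, (Rabs_pos_eq (rpow _ _)) by apply rpow_ge0.
assert (q1 : rpow (Rabs x) alpha <= 1) by (apply rpow_le_1; [assumption |]; rewrite Rabs_pos_eq; lra).
assert (q2 := rpow_lipschitz a b M (p - 1) ltac:(lra) h1 h2 hM).
replace (p - 1 - 1) with (p - 2) in q2 by ring.
assert (q3 := rpow_ge0 (Rabs x) alpha).
assert (q4 := Rabs_pos (rpow a (p - 1) - rpow b (p - 1))). nra.
Qed.

Lemma solution_even (alpha p : R) (u u' : R -> R) :
  0 < alpha -> 2 < p -> classical_solution alpha p u u' ->
  (p - 1) * Rpower (2 * u 0) (p - 2) <= eigenvalue alpha (nu alpha) ->
  u' 0 = 0 /\ forall x, -1 <= x <= 1 -> u (- x) = u x.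
Proof.
intros ha hp hu hgap.
assert (hr := classical_solution_reflect _ _ _ _ hu).
assert (h1 := slope_at_0_not_pos alpha p u u' ha hp hu hgap).
assert (h2 := slope_at_0_not_pos alpha p _ _ ha hp hr).
cbv beta in h2. rewrite Ropp_0 in h2. specialize (h2 hgap).
assert (e : u' 0 = 0) by lra.
split; [exact e |].
assert (hu0 : 0 < u 0) by (apply (cs_pos _ _ _ _ hu); lra).
assert (hM : 0 < 2 * u 0) by lra.
assert (hin : forall x, 0 <= x < 1 -> u x = u (- x)).
{ apply (second_order_uniqueness u (fun x => u (- x)) u' (fun x => - u' (- x))
    (fun x => - (rpow (Rabs x) alpha * rpow (u x) (p - 1)))
    (fun x => - (rpow (Rabs x) alpha * rpow (u (- x)) (p - 1)))
    ((p - 1) * Rpower (2 * u 0) (p - 2))).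
  - apply Rmult_le_pos; [lra | left; apply exp_pos].
  - intros x hx. split; [apply (cs_deriv _ _ _ _ hu) | apply (cs_deriv _ _ _ _ hr)]; lra.
  - intros x hx. split; [apply (cs_eq _ _ _ _ hu) | apply (cs_eq _ _ _ _ hr)]; lra.
  - intros x hx. apply nonlinearity_lipschitz; try lra.
    + split; left; [apply (cs_pos _ _ _ _ hu) | apply (solution_lt alpha p u u' x hu)]; lra.
    + split; left; [apply (cs_pos _ _ _ _ hu) | apply (solution_lt alpha p u u' (- x) hu)]; lra.
  - now rewrite Ropp_0.
  - rewrite Ropp_0. lra. }
assert (h11 : u 1 = u (- (1))).
{ replace (- (1)) with (-1) by ring. now rewrite (cs_left _ _ _ _ hu), (cs_right _ _ _ _ hu). }
assert (hin1 : forall x, 0 <= x <= 1 -> u x = u (- x)).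
{ intros x [hx [hx1 | ->]]; [apply hin; lra | exact h11]. }
intros x hx. destruct (Rle_dec 0 x).
- symmetry. apply hin1. lra.
- rewrite (hin1 (- x)), Ropp_involutive by lra. reflexivity.
Qed.

(** Rescale [u] to [s u(k x)] so that it has the value [v(0)] at [0].  Since [v 0 <= u 0], one has
    [k <= 1] and the rescaled function is defined on [[0, 1]]; it agrees with [v], so it vanishes
    at [1], which forces [k = 1]. *)
Lemma even_solution_unique (alpha p : R) (u u' v v' : R -> R) :
  0 < alpha -> 2 < p ->
  classical_solution alpha p u u' -> classical_solution alpha p v v' ->
  u' 0 = 0 -> v' 0 = 0 -> v 0 <= u 0 ->
  forall x, 0 <= x <= 1 -> v x = u x.
Proof.
intros ha hp hu hv eu ev hle.
assert (hu0 : 0 < u 0) by (apply (cs_pos _ _ _ _ hu); lra).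
assert (hv0 : 0 < v 0) by (apply (cs_pos _ _ _ _ hv); lra).
set (s := v 0 / u 0).
assert (hs : 0 < s) by now apply Rdiv_lt_0_compat.
set (k := Rpower s ((p - 2) / (alpha + 2))).
assert (hk0 : 0 < k) by apply exp_pos.
assert (hexp : 0 < (p - 2) / (alpha + 2)) by (apply Rdiv_lt_0_compat; lra).
assert (hs1 : s <= 1).
{ unfold s. apply (Rmult_le_reg_r (u 0)); [assumption |]. unfold Rdiv.
  rewrite Rmult_assoc, Rinv_l; lra. }
assert (hk1 : k <= 1).
{ unfold k. rewrite <- (Rpower_base_1 ((p - 2) / (alpha + 2))). apply Rle_Rpower_l; lra. }
(* The exponent in [k] is chosen for this: [s * u (k * x)] solves the equation exactly
   when [s ^ (p - 2) = k ^ (alpha + 2)]. *)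
assert (hks : s * k * k * rpow k alpha = rpow s (p - 1)).
{ assert (q1 : rpow k (alpha + 2) = Rpower s (p - 2)).
  { rewrite rpow_pos by assumption. unfold k. rewrite Rpower_mult. f_equal. field. lra. }
  replace (alpha + 2) with (alpha + 1 + 1) in q1 by ring. rewrite !rpow_succ in q1 by lra.
  replace (p - 1) with (p - 2 + 1) by ring.
  rewrite rpow_succ, (rpow_pos s), <- q1 by lra. ring. }
assert (hkx : forall x, 0 <= x < 1 -> -1 < k * x < 1) by (intros; nra).
assert (hsu : s * u 0 = v 0) by (unfold s; field; lra).
assert (heq : forall x, 0 <= x < 1 -> v x = s * u (k * x)).
{ apply (second_order_uniqueness v (fun x => s * u (k * x)) v' (fun x => s * (k * u' (k * x)))
    (fun x => - (rpow (Rabs x) alpha * rpow (v x) (p - 1)))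
    (fun x => - (rpow (Rabs x) alpha * rpow (s * u (k * x)) (p - 1)))
    ((p - 1) * Rpower (2 * v 0) (p - 2))).
  - apply Rmult_le_pos; [lra | left; apply exp_pos].
  - intros x hx. split; [apply (cs_deriv _ _ _ _ hv); lra |].
    apply (is_derive_scal (fun t => u (k * t))), is_derive_scale_arg, (cs_deriv _ _ _ _ hu). auto.
  - intros x hx. split; [apply (cs_eq _ _ _ _ hv); lra |].
    assert (q := cs_pos _ _ _ _ hu (k * x) (hkx x hx)).
    replace (- (rpow (Rabs x) alpha * rpow (s * u (k * x)) (p - 1)))
      with (s * (k * (k * - (rpow (Rabs (k * x)) alpha * rpow (u (k * x)) (p - 1))))).
    + apply (is_derive_scal (fun t => k * u' (k * t))), (is_derive_scal (fun t => u' (k * t))).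
      apply is_derive_scale_arg, (cs_eq _ _ _ _ hu). auto.
    + rewrite Rabs_mult, (Rabs_pos_eq k) by lra.
      rewrite (rpow_mult_distr s), (rpow_mult_distr k), <- hks by (try apply Rabs_pos; lra). ring.
  - intros x hx. apply nonlinearity_lipschitz; try lra.
    + split; left; [apply (cs_pos _ _ _ _ hv) | apply (solution_lt alpha p v v' x hv)]; lra.
    + assert (q := cs_pos _ _ _ _ hu (k * x) (hkx x hx)).
      assert (q' := solution_lt alpha p u u' (k * x) hu (hkx x hx)).
      split; [nra |]. rewrite <- hsu. nra.
  - rewrite Rmult_0_r. lra.
  - rewrite Rmult_0_r, eu, ev. ring. }
assert (hend : s * u (k * 1) <= 0).
{ enough (h : s * u (k * 1) - v 1 <= 0) by (rewrite (cs_right _ _ _ _ hv) in h; lra).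
  apply (le_at_right_end (fun x => s * u (k * x) - v x) 0 1 0); [lra | |].
  - apply continuous_Rminus; [| apply (cs_cont _ _ _ _ hv)].
    apply continuous_Rmult; [apply continuous_const |].
    apply (continuous_comp (fun t => k * t) u); [| apply (cs_cont _ _ _ _ hu)].
    apply continuous_Rmult; [apply continuous_const | apply continuous_id].
  - intros x hx. rewrite (heq x) by lra. lra. }
assert (hk : k = 1).
{ destruct hk1 as [hlt | e]; [exfalso | exact e].
  assert (q := cs_pos _ _ _ _ hu (k * 1) ltac:(lra)). nra. }
assert (hs' : s = 1).
{ destruct hs1 as [hlt | e]; [exfalso | exact e].
  assert (k < 1); [| lra]. unfold k. rewrite <- (Rpower_base_1 ((p - 2) / (alpha + 2))).
  unfold Rpower. apply exp_increasing, Rmult_lt_compat_l; [assumption |].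
  now apply ln_increasing. }
intros x [hx [hx1 | ->]].
- rewrite (heq x), hk, hs', !Rmult_1_l by lra. reflexivity.
- now rewrite (cs_right _ _ _ _ hv), (cs_right _ _ _ _ hu).
Qed.

(** * Cauchy problem by Picard iteration *)

(** The weight [exp (K |x|)] makes integration a contraction on the whole line when [K] is large,
    so that Picard iterates converge geometrically without a bound on the interval. *)
Lemma exp_weight_integral (F f : R -> R) (A K : R) :
  0 < K -> 0 <= A -> (forall x, is_derive F x (f x)) -> F 0 = 0 ->
  (forall x, Rabs (f x) <= A * exp (K * Rabs x)) ->
  forall x, Rabs (F x) <= A / K * exp (K * Rabs x).
Proof.
intros hK hA.
assert (hAK : 0 <= A / K) by (apply Rmult_le_pos; [| left; apply Rinv_0_lt_compat]; assumption).
assert (one_sided : forall F f : R -> R, (forall x, is_derive F x (f x)) -> F 0 = 0 ->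
  (forall x, Rabs (f x) <= A * exp (K * Rabs x)) ->
  forall x, 0 <= x -> F x <= A / K * exp (K * x)).
{ clear F f. intros F f hd h0 hb x hx.
  assert (h : F x - A / K * exp (K * x) <= F 0 - A / K * exp (K * 0)).
  { apply (derive_nonpos_le (fun t => F t - A / K * exp (K * t)) (fun t => f t - A * exp (K * t)) 0 x hx).
    - intros t _. apply (is_derive_minus F (fun t => A / K * exp (K * t))); [apply hd |].
      auto_derive; [trivial | field; lra].
    - intros t _. apply continuous_Rminus.
      + apply (ex_derive_continuous F). eexists. apply hd.
      + apply (ex_derive_continuous (fun t => A / K * exp (K * t))). now auto_derive.
    - intros t ht. specialize (hb t). rewrite (Rabs_pos_eq t) in hb by lra.
      assert (q := Rle_abs (f t)). lra. }
  rewrite h0, Rmult_0_r, exp_0 in h. lra. }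
assert (two_sided : forall F f : R -> R, (forall x, is_derive F x (f x)) -> F 0 = 0 ->
  (forall x, Rabs (f x) <= A * exp (K * Rabs x)) ->
  forall x, 0 <= x -> Rabs (F x) <= A / K * exp (K * x)).
{ clear F f. intros F f hd h0 hb x hx. apply Rabs_le. split; [| now apply (one_sided F f)].
  enough (- F x <= A / K * exp (K * x)) by lra.
  apply (one_sided (fun t => - F t) (fun t => - f t)); [| lra | | exact hx].
  - intros t. apply (is_derive_opp F). apply hd.
  - intros t. rewrite Rabs_Ropp. apply hb. }
intros hd h0 hb x.
destruct (Rle_dec 0 x) as [hx | hx].
- rewrite (Rabs_pos_eq x) by assumption. now apply (two_sided F f).
- rewrite (Rabs_left x) by lra.
  replace (F x) with (F (- - x)) by (f_equal; ring).
  apply (two_sided (fun t => F (- t)) (fun t => - f (- t))); [| now rewrite Ropp_0 | | lra].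
  + intros t. now apply is_derive_neg_arg.
  + intros t. rewrite Rabs_Ropp, <- (Rabs_Ropp t). apply hb.
Qed.

(** Second-order equation [y'' = g x y] with [y' 0 = 0]: one integration gives the slope, a second
    one the next iterate. *)
Definition picard_slope (g : R -> R -> R) (y : R -> R) (x : R) : R :=
  RInt (fun s => g s (y s)) 0 x.

Definition picard_map (g : R -> R -> R) (a : R) (y : R -> R) (x : R) : R :=
  a + RInt (picard_slope g y) 0 x.

Fixpoint picard (g : R -> R -> R) (a : R) (n : nat) : R -> R :=
  match n with
  | O => fun _ => a
  | S m => picard_map g a (picard g a m)
  end.

Lemma picard_map_deriv (g : R -> R -> R) (a : R) (y : R -> R) :
  (forall x, continuous (fun s => g s (y s)) x) ->
  forall x, is_derive (picard_map g a y) x (picard_slope g y x) /\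
            is_derive (picard_slope g y) x (g x (y x)).
Proof.
intros hc.
assert (hs : forall x, is_derive (picard_slope g y) x (g x (y x))).
{ intros x. now apply (is_derive_primitive (fun s => g s (y s))). }
intros x. split; [| apply hs].
replace (picard_slope g y x) with (plus 0 (picard_slope g y x)) by (unfold plus; simpl; ring).
apply (is_derive_plus (fun _ => a) (fun x => RInt (picard_slope g y) 0 x)).
- auto_derive; trivial.
- apply is_derive_primitive. intros t. apply (ex_derive_continuous (picard_slope g y)).
  eexists. apply hs.
Qed.

Lemma picard_map_0 (g : R -> R -> R) (a : R) (y : R -> R) : picard_map g a y 0 = a.
Proof. unfold picard_map. rewrite RInt_point. unfold zero; simpl. ring. Qed.

Lemma picard_slope_0 (g : R -> R -> R) (y : R -> R) : picard_slope g y 0 = 0.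
Proof. unfold picard_slope. now rewrite RInt_point. Qed.

(** Two integrations gain a factor [L / K^2], at most one half. *)
Lemma picard_map_contracts (g : R -> R -> R) (a L A K : R) (y z : R -> R) :
  0 < K -> 0 <= A -> 0 <= L -> 2 * L <= K * K ->
  (forall s b c, Rabs (g s b - g s c) <= L * Rabs (b - c)) ->
  (forall x, continuous (fun s => g s (y s)) x) ->
  (forall x, continuous (fun s => g s (z s)) x) ->
  (forall x, Rabs (y x - z x) <= A * exp (K * Rabs x)) ->
  forall x, Rabs (picard_map g a y x - picard_map g a z x) <= A / 2 * exp (K * Rabs x).
Proof.
intros hK hA hL hLK hlip hy hz hyz x.
assert (dy := picard_map_deriv g a y hy). assert (dz := picard_map_deriv g a z hz).
assert (h1 : forall x, Rabs (picard_slope g y x - picard_slope g z x) <= L * A / K * exp (K * Rabs x)).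
{ apply (exp_weight_integral (fun x => picard_slope g y x - picard_slope g z x)
    (fun x => g x (y x) - g x (z x))); [assumption | nra | | |].
  - intros t. apply (is_derive_minus (picard_slope g y)); [apply dy | apply dz].
  - rewrite !picard_slope_0. ring.
  - intros t. eapply Rle_trans; [apply hlip |]. rewrite Rmult_assoc.
    apply Rmult_le_compat_l; [assumption | apply hyz]. }
assert (h2 : Rabs (picard_map g a y x - picard_map g a z x) <= L * A / K / K * exp (K * Rabs x)).
{ apply (exp_weight_integral (fun x => picard_map g a y x - picard_map g a z x)
    (fun x => picard_slope g y x - picard_slope g z x)); [assumption | | | | exact h1].
  - apply Rmult_le_pos; [nra | left; now apply Rinv_0_lt_compat].
  - intros t. apply (is_derive_minus (picard_map g a y)); [apply dy | apply dz].
  - rewrite !picard_map_0. ring. }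
eapply Rle_trans; [exact h2 |]. apply Rmult_le_compat_r; [left; apply exp_pos |].
apply (Rmult_le_reg_r (2 * (K * K))); [nra |].
replace (L * A / K / K * (2 * (K * K))) with (2 * L * A) by (field; lra).
replace (A / 2 * (2 * (K * K))) with (K * K * A) by field.
now apply Rmult_le_compat_r.
Qed.

(** In the weighted norm the iterates form a Cauchy sequence with ratio one half; the limit
    is continuous because convergence is locally uniform, and it is a fixed point of
    [picard_map] because the latter is a contraction. *)
Lemma second_order_existence (g : R -> R -> R) (a L B : R) :
  0 <= L -> 0 <= B ->
  (forall s b c, Rabs (g s b - g s c) <= L * Rabs (b - c)) ->
  (forall s b, Rabs (g s b) <= B) ->
  (forall y : R -> R, (forall x, continuous y x) -> forall x, continuous (fun s => g s (y s)) x) ->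
  exists y y' : R -> R, y 0 = a /\ y' 0 = 0 /\
    (forall x, is_derive y x (y' x)) /\ (forall x, is_derive y' x (g x (y x))).
Proof.
intros hL hB hlip hbd hcont.
(* Any [K] with [1 <= K] and [2 L <= K^2] would do. *)
set (K := 2 * L + 1). assert (hK : 1 <= K) by (unfold K; lra).
assert (hLK : 2 * L <= K * K) by (unfold K; nra).
set (Y := picard g a).
assert (hYc : forall n x, continuous (Y n) x).
{ induction n as [| n IH]; intros x; [apply continuous_const |].
  apply (ex_derive_continuous (Y (S n))). eexists.
  exact (proj1 (picard_map_deriv g a (Y n) (hcont (Y n) IH) x)). }
set (w := fun x => exp (K * Rabs x)).
assert (hw : forall x, 0 < w x) by (intros; apply exp_pos).
assert (hstep : forall n x, Rabs (Y (S n) x - Y n x) <= B * (/ 2) ^ n * w x).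
{ induction n as [| n IH]; intros x.
  - assert (d := picard_map_deriv g a (Y 0%nat) ltac:(now apply hcont)).
    assert (h1 : forall x, Rabs (picard_slope g (Y 0%nat) x) <= B / K * exp (K * Rabs x)).
    { apply (exp_weight_integral _ (fun x => g x (Y 0%nat x))); [lra | assumption | apply d | apply picard_slope_0 |].
      intros t. eapply Rle_trans; [apply hbd |].
      assert (h := exp_ineq1_le (K * Rabs t)).
      assert (h' : 0 <= K * Rabs t) by (apply Rmult_le_pos; [lra | apply Rabs_pos]).
      rewrite <- (Rmult_1_r B) at 1. apply Rmult_le_compat_l; lra. }
    assert (hBK : B / K <= B).
    { apply (Rmult_le_reg_r K); [lra |]. unfold Rdiv. rewrite Rmult_assoc, Rinv_l by lra. nra. }
    assert (h2 : Rabs (Y 1%nat x - Y 0%nat x) <= B / K * exp (K * Rabs x)).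
    { apply Rle_trans with (B / K / K * exp (K * Rabs x)).
      - apply (exp_weight_integral (fun x => Y 1%nat x - Y 0%nat x) (picard_slope g (Y 0%nat)));
          [lra | apply Rmult_le_pos; [assumption | left; apply Rinv_0_lt_compat; lra] | | | exact h1].
        + intros t. replace (picard_slope g (Y 0%nat) t) with (picard_slope g (Y 0%nat) t - 0) by ring.
          apply (is_derive_minus (Y 1%nat) (fun _ => a)); [apply d | auto_derive; trivial].
        + change (Y 1%nat 0) with (picard_map g a (Y 0%nat) 0). rewrite picard_map_0. unfold Y; simpl. ring.
      - apply Rmult_le_compat_r; [left; apply exp_pos |].
        assert (0 <= B / K) by (apply Rmult_le_pos; [assumption | left; apply Rinv_0_lt_compat; lra]).
        apply (Rmult_le_reg_r K); [lra |]. unfold Rdiv at 1. rewrite Rmult_assoc, Rinv_l by lra. nra. }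
    eapply Rle_trans; [exact h2 |]. simpl. rewrite Rmult_1_r.
    apply Rmult_le_compat_r; [left; apply exp_pos | assumption].
  - replace (B * (/ 2) ^ S n) with (B * (/ 2) ^ n / 2) by (simpl; field).
    apply (picard_map_contracts g a L (B * (/ 2) ^ n) K (Y (S n)) (Y n)); try assumption; try lra.
    + apply Rmult_le_pos; [assumption |]. apply pow_le. lra.
    + now apply hcont.
    + now apply hcont. }
assert (hcauchy : forall x n k, Rabs (Y (n + k)%nat x - Y n x) <= 2 * B * (/ 2) ^ n * (1 - (/ 2) ^ k) * w x).
{ intros x n. induction k as [| k IH].
  - rewrite Nat.add_0_r, Rminus_diag, Rabs_R0. simpl. lra.
  - rewrite Nat.add_succ_r.
    replace (Y (S (n + k)) x - Y n x) with ((Y (S (n + k)) x - Y (n + k)%nat x) + (Y (n + k)%nat x - Y n x)) by ring.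
    eapply Rle_trans; [apply Rabs_triang |].
    assert (h := hstep (n + k)%nat x). rewrite pow_add in h.
    replace (2 * B * (/ 2) ^ n * (1 - (/ 2) ^ S k) * w x)
      with (B * ((/ 2) ^ n * (/ 2) ^ k) * w x + 2 * B * (/ 2) ^ n * (1 - (/ 2) ^ k) * w x)
      by (simpl; field).
    now apply Rplus_le_compat. }
assert (hcauchy' : forall x n m, (n <= m)%nat -> Rabs (Y m x - Y n x) <= 2 * B * (/ 2) ^ n * w x).
{ intros x n m hnm. replace m with (n + (m - n))%nat by lia.
  eapply Rle_trans; [apply hcauchy |]. apply Rmult_le_compat_r; [left; apply hw |].
  assert (0 <= (/ 2) ^ n) by (apply pow_le; lra). assert (0 <= (/ 2) ^ (m - n)) by (apply pow_le; lra).
  assert (0 <= 2 * B * (/ 2) ^ n) by (apply Rmult_le_pos; lra).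
  assert (0 <= 2 * B * (/ 2) ^ n * (/ 2) ^ (m - n)) by (apply Rmult_le_pos; assumption). lra. }
assert (hsmall : forall C e, 0 <= C -> 0 < e -> exists n, C * (/ 2) ^ n < e).
{ intros C e hC he.
  assert (hg : is_lim_seq (fun n => C * (/ 2) ^ n) (Finite (C * 0))).
  { apply (is_lim_seq_scal_l (fun n => (/ 2) ^ n) C 0). apply is_lim_seq_geom.
    rewrite Rabs_pos_eq; lra. }
  rewrite Rmult_0_r in hg. apply is_lim_seq_spec in hg.
  destruct (hg (mkposreal e he)) as [n hn]. exists n.
  specialize (hn n (le_n n)). simpl in hn. apply Rabs_def2 in hn. lra. }
set (y := fun x => real (Lim_seq (fun n => Y n x))).
assert (hy : forall x, is_lim_seq (fun n => Y n x) (y x)).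
{ intros x. apply Lim_seq_correct', ex_lim_seq_cauchy_corr. intros [e he].
  destruct (hsmall (2 * (2 * B * w x)) e) as [N hN]; [specialize (hw x); nra | assumption |].
  exists N. intros n m hn hm. simpl.
  replace (Y n x - Y m x) with ((Y n x - Y N x) - (Y m x - Y N x)) by ring.
  eapply Rle_lt_trans; [apply Rabs_triang |]. rewrite Rabs_Ropp.
  assert (h1 := hcauchy' x N n hn). assert (h2 := hcauchy' x N m hm). lra. }
assert (hyY : forall n x, Rabs (y x - Y n x) <= 2 * B * (/ 2) ^ n * w x).
{ intros n x.
  apply (is_lim_seq_le_loc (fun m => Rabs (Y m x - Y n x)) (fun _ => 2 * B * (/ 2) ^ n * w x)
    (Rabs (y x - Y n x)) (2 * B * (/ 2) ^ n * w x)).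
  - exists n. intros m hm. now apply hcauchy'.
  - apply (is_lim_seq_abs _ (y x - Y n x)).
    apply is_lim_seq_minus'; [apply hy | apply is_lim_seq_const].
  - apply is_lim_seq_const. }
assert (hyc : forall x, continuous y x).
{ intros x. apply filterlim_locally. intros [e he].
  (* Bound of the weight on the unit neighbourhood of [x]. *)
  set (W := exp (K * (Rabs x + 1))).
  assert (hW : 0 < W) by apply exp_pos.
  destruct (hsmall (2 * B * W) (e / 3)) as [n hn]; [nra | lra |].
  destruct (proj1 (filterlim_locally _ _) (hYc n x) (mkposreal (e / 3) ltac:(lra))) as [d hd].
  exists (mkposreal (Rmin d 1) ltac:(apply Rmin_pos; [apply cond_pos | lra])).
  intros t ht.
  assert (ht1 : Rabs (t - x) < d) by (eapply Rlt_le_trans; [exact ht | apply Rmin_l]).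
  assert (ht2 : Rabs (t - x) < 1) by (eapply Rlt_le_trans; [exact ht | apply Rmin_r]).
  specialize (hd t ht1).
  unfold ball in *; simpl in *; unfold AbsRing_ball, abs, minus, plus, opp in *; simpl in *.
  assert (hwt : w t <= W).
  { assert (Rabs t <= Rabs x + 1).
    { replace t with (x + (t - x)) by ring. eapply Rle_trans; [apply Rabs_triang |]. lra. }
    assert (hh : K * Rabs t <= K * (Rabs x + 1)) by (apply Rmult_le_compat_l; lra).
    unfold w, W. destruct hh as [hh | ->]; [left; now apply exp_increasing | lra]. }
  assert (hwx : w x <= W) by (left; apply exp_increasing; nra).
  assert (hn0 : 0 <= 2 * B * (/ 2) ^ n) by (apply Rmult_le_pos; [lra | apply pow_le; lra]).
  assert (h1 := hyY n t). assert (h2 := hyY n x).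
  assert (2 * B * (/ 2) ^ n * w t <= 2 * B * (/ 2) ^ n * W) by (apply Rmult_le_compat_l; lra).
  assert (2 * B * (/ 2) ^ n * w x <= 2 * B * (/ 2) ^ n * W) by (apply Rmult_le_compat_l; lra).
  apply Rabs_def2 in hd.
  assert (h1' : Rabs (y t - Y n t) < e / 3) by lra. assert (h2' : Rabs (y x - Y n x) < e / 3) by lra.
  apply Rabs_def2 in h1'. apply Rabs_def2 in h2'.
  apply Rabs_def1; lra. }
assert (hgy : forall x, continuous (fun s => g s (y s)) x) by now apply hcont.
assert (hfix : forall x, picard_map g a y x = y x).
{ intros x. apply Rminus_diag_uniq. destruct (Req_dec (picard_map g a y x - y x) 0) as [e | ne]; [exact e | exfalso].
  apply Rabs_pos_lt in ne.
  destruct (hsmall (2 * B * w x) _ (ltac:(specialize (hw x); nra)) ne) as [n hn].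
  assert (h1 := picard_map_contracts g a L (2 * B * (/ 2) ^ n) K y (Y n) ltac:(lra)
    ltac:(apply Rmult_le_pos; [lra | apply pow_le; lra]) hL hLK hlip hgy ltac:(now apply hcont) (hyY n) x).
  assert (h2 := hyY (S n) x).
  change (picard_map g a (Y n) x) with (Y (S n) x) in h1. fold (w x) in h1.
  replace (2 * B * (/ 2) ^ S n * w x) with (2 * B * (/ 2) ^ n / 2 * w x) in h2 by (simpl; field).
  assert (h3 : Rabs (picard_map g a y x - y x) <= Rabs (picard_map g a y x - Y (S n) x) + Rabs (y x - Y (S n) x)).
  { replace (picard_map g a y x - y x) with ((picard_map g a y x - Y (S n) x) - (y x - Y (S n) x)) by ring.
    eapply Rle_trans; [apply Rabs_triang |]. rewrite Rabs_Ropp. lra. }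
  lra. }
exists y, (picard_slope g y).
assert (d := picard_map_deriv g a y hgy).
split; [| split; [| split]].
- rewrite <- hfix. apply picard_map_0.
- apply picard_slope_0.
- intros x. apply (is_derive_ext (picard_map g a y)); [exact hfix | apply d].
- intros x. apply d.
Qed.

(** * Existence by shooting *)

(** Clamping both arguments makes the right-hand side bounded and Lipschitz; on
    [|x| <= 1], [0 <= y <= 1] it is the original one. *)
Definition truncated_force (alpha p Lam x y : R) : R :=
  - Lam * (rpow (Rabs (clamp x)) alpha * rpow (Rabs (clamp y)) (p - 1)).

(** Evenness follows from uniqueness for the Cauchy problem, the right-hand side being even in
    [x]. *)
Lemma shooting_profile (alpha p Lam : R) : 0 < alpha -> 2 < p -> 0 < Lam ->
  exists y y' : R -> R, y 0 = 1 /\ y' 0 = 0 /\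
    (forall x, is_derive y x (y' x)) /\
    (forall x, is_derive y' x (truncated_force alpha p Lam x (y x))) /\
    (forall x, y (- x) = y x).
Proof.
intros ha hp hL.
set (g := truncated_force alpha p Lam).
assert (hq : forall s, 0 <= rpow (Rabs (clamp s)) alpha <= 1).
{ intros s. split; [apply rpow_ge0 | apply rpow_le_1; [lra | apply Rabs_clamp]]. }
assert (hf : forall b, 0 <= rpow (Rabs (clamp b)) (p - 1) <= 1).
{ intros s. split; [apply rpow_ge0 | apply rpow_le_1; [lra | apply Rabs_clamp]]. }
assert (hlip : forall s b c, Rabs (g s b - g s c) <= Lam * (p - 1) * Rabs (b - c)).
{ intros s b c. unfold g, truncated_force.
  replace (- Lam * (rpow (Rabs (clamp s)) alpha * rpow (Rabs (clamp b)) (p - 1))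
     - - Lam * (rpow (Rabs (clamp s)) alpha * rpow (Rabs (clamp c)) (p - 1)))
    with (- (Lam * rpow (Rabs (clamp s)) alpha
           * (rpow (Rabs (clamp b)) (p - 1) - rpow (Rabs (clamp c)) (p - 1)))) by ring.
  rewrite Rabs_Ropp, Rabs_mult, Rabs_pos_eq by (specialize (hq s); nra).
  assert (h := rpow_lipschitz (Rabs (clamp b)) (Rabs (clamp c)) 1 (p - 1) ltac:(lra)
    (Rabs_clamp b) (Rabs_clamp c) Rlt_0_1).
  rewrite Rpower_base_1 in h.
  assert (h1 := Rabs_triang_inv2 (clamp b) (clamp c)).
  assert (h2 := clamp_lipschitz c b).
  set (D := Rabs (rpow (Rabs (clamp b)) (p - 1) - rpow (Rabs (clamp c)) (p - 1))) in *.
  assert (h3 : D <= (p - 1) * Rabs (b - c)).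
  { eapply Rle_trans; [exact h |]. rewrite Rmult_1_r. apply Rmult_le_compat_l; lra. }
  assert (h4 : 0 <= D) by apply Rabs_pos.
  specialize (hq s).
  assert (h5 : rpow (Rabs (clamp s)) alpha * D <= (p - 1) * Rabs (b - c)) by nra.
  rewrite !Rmult_assoc. apply Rmult_le_compat_l; lra. }
assert (hbd : forall s b, Rabs (g s b) <= Lam).
{ intros s b. unfold g, truncated_force. specialize (hq s). specialize (hf b).
  assert (h : 0 <= rpow (Rabs (clamp s)) alpha * rpow (Rabs (clamp b)) (p - 1) <= 1).
  { split; [now apply Rmult_le_pos |]. replace 1 with (1 * 1) at 2 by ring. apply Rmult_le_compat; lra. }
  rewrite Rabs_left1 by nra. nra. }
assert (hcont : forall y : R -> R, (forall x, continuous y x) -> forall x, continuous (fun s => g s (y s)) x).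
{ intros y hy x. unfold g, truncated_force.
  apply continuous_Rmult; [apply continuous_const |]. apply continuous_Rmult.
  - apply (continuous_comp clamp (fun t => rpow (Rabs t) alpha)); [apply continuous_clamp |].
    now apply continuous_rpow_abs.
  - apply (continuous_comp (fun s => clamp (y s)) (fun t => rpow (Rabs t) (p - 1))).
    + apply (continuous_comp y clamp); [apply hy | apply continuous_clamp].
    + apply continuous_rpow_abs. lra. }
destruct (second_order_existence g 1 (Lam * (p - 1)) Lam) as (y & y' & e0 & e1 & h1 & h2);
  [nra | lra | assumption | assumption | assumption |].
exists y, y'. split; [exact e0 |]. split; [exact e1 |]. split; [exact h1 |]. split; [exact h2 |].
assert (hev : forall x, 0 <= x -> y x = y (- x)).
{ intros x hx.
  apply (second_order_uniqueness y (fun t => y (- t)) y' (fun t => - y' (- t))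
    (fun t => g t (y t)) (fun t => g t (y (- t))) (Lam * (p - 1)) (x + 1)).
  - nra.
  - intros t _. split; [apply h1 | apply is_derive_neg_arg, h1].
  - intros t _. split; [apply h2 |].
    replace (g t (y (- t))) with (opp (- g (- t) (y (- t)))).
    + apply (is_derive_opp (fun t => y' (- t))), is_derive_neg_arg, h2.
    + unfold opp; simpl. unfold g, truncated_force. rewrite clamp_opp, Rabs_Ropp. ring.
  - intros t _. apply hlip.
  - now rewrite Ropp_0.
  - rewrite Ropp_0, e1. ring.
  - lra. }
intros x. destruct (Rle_dec 0 x).
- symmetry. now apply hev.
- rewrite (hev (- x)), Ropp_involutive by lra. reflexivity.
Qed.

(** If [y 1 > 0], concavity gives [y x >= 1 - x] on [[0, 1]], hence [y >= 1/2] on [[1/4, 1/2]];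
    integrating the equation there makes [y' (1/2)] at most [- Lam m / 4] with [m] as below,
    which contradicts [y 1 > 0] when [Lam m = 8]. *)
Lemma shooting_zero (alpha p : R) : 0 < alpha -> 2 < p ->
  exists (Lam z : R) (y y' : R -> R), 0 < Lam /\ 0 < z <= 1 /\
    (forall x, is_derive y x (y' x)) /\
    (forall x, is_derive y' x (truncated_force alpha p Lam x (y x))) /\
    (forall x, - z < x < z -> 0 < y x <= 1) /\ y z = 0 /\ y (- z) = 0.
Proof.
intros ha hp.
set (m := rpow (1 / 4) alpha * rpow (1 / 2) (p - 1)).
assert (hm : 0 < m) by (apply Rmult_lt_0_compat; apply rpow_gt0; lra).
set (Lam := 8 / m).
assert (hL : 0 < Lam) by (apply Rdiv_lt_0_compat; lra).
destruct (shooting_profile alpha p Lam ha hp hL) as (y & y' & e0 & e1 & h1 & h2 & hev).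
assert (hneg : forall s b, truncated_force alpha p Lam s b <= 0).
{ intros s b. unfold truncated_force.
  assert (q1 := rpow_ge0 (Rabs (clamp s)) alpha). assert (q2 := rpow_ge0 (Rabs (clamp b)) (p - 1)).
  assert (0 <= rpow (Rabs (clamp s)) alpha * rpow (Rabs (clamp b)) (p - 1)) by now apply Rmult_le_pos.
  nra. }
assert (c1 : forall x, continuous y x).
{ intros x. apply (ex_derive_continuous y). eexists. apply h1. }
assert (c2 : forall x, continuous y' x).
{ intros x. apply (ex_derive_continuous y'). eexists. apply h2. }
assert (hdec : forall a b, a <= b -> y' b <= y' a).
{ intros a b hab. apply (derive_nonpos_le y' (fun x => truncated_force alpha p Lam x (y x)) a b hab); auto. }
assert (hy1 : forall x, 0 <= x -> y x <= 1).
{ intros x hx. rewrite <- e0. apply (derive_nonpos_le y y' 0 x hx); auto.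
  intros t ht. rewrite <- e1. apply hdec. lra. }
assert (hend : y 1 <= 0).
{ destruct (Rle_dec (y 1) 0) as [h | h]; [exact h | exfalso].
  assert (hlow : forall x, 0 <= x <= 1 -> 1 - x <= y x).
  { intros x hx.
    assert (q := concave_above_chord y y' 0 1 ltac:(auto) ltac:(auto) ltac:(auto) x hx).
    rewrite e0 in q. assert (0 <= y 1 * x) by (apply Rmult_le_pos; lra). lra. }
  destruct (mvt_open y' (fun x => truncated_force alpha p Lam x (y x)) (1 / 4) (1 / 2)) as [c [q1 q2]];
    [lra | auto | auto |].
  destruct (mvt_open y y' (1 / 2) 1) as [d [q3 q4]]; [lra | auto | auto |].
  assert (q5 := hdec 0 (1 / 4) ltac:(lra)). rewrite e1 in q5.
  assert (q6 := hdec (1 / 2) d ltac:(lra)).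
  assert (q7 := hy1 (1 / 2) ltac:(lra)).
  assert (q8 : truncated_force alpha p Lam c (y c) <= - Lam * m).
  { unfold truncated_force. assert (hc1 := hlow c ltac:(lra)). assert (hc2 := hy1 c ltac:(lra)).
    rewrite !clamp_id, !Rabs_pos_eq by lra.
    assert (p1 : rpow (1 / 4) alpha <= rpow c alpha) by (apply rpow_le; lra).
    assert (p2 : rpow (1 / 2) (p - 1) <= rpow (y c) (p - 1)) by (apply rpow_le; lra).
    assert (p3 := rpow_ge0 (1 / 4) alpha). assert (p4 := rpow_ge0 (1 / 2) (p - 1)).
    assert (m <= rpow c alpha * rpow (y c) (p - 1)) by (apply Rmult_le_compat; assumption).
    nra. }
  assert (q9 : Lam * m = 8) by (unfold Lam; field; lra).
  lra. }
destruct (first_zero y 0 1) as [z [hz [ez hpos]]]; [lra | auto | lra | exact hend |].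
exists Lam, z, y, y'. split; [exact hL |]. split; [exact hz |]. split; [exact h1 |]. split; [exact h2 |].
split; [| split; [exact ez | now rewrite hev]].
intros x hx. destruct (Rle_dec 0 x).
- split; [apply hpos | apply hy1]; lra.
- rewrite <- hev. split; [apply hpos | apply hy1]; lra.
Qed.

(** The function [C y(z x)] solves the equation when [C^(p-2) = Lam z^(alpha+2)], and its first
    zeros are at [-1] and [1]. *)
Lemma solution_exists (alpha p : R) : 0 < alpha -> 2 < p ->
  exists u u', classical_solution alpha p u u'.
Proof.
intros ha hp.
destruct (shooting_zero alpha p ha hp) as (Lam & z & y & y' & hL & hz & h1 & h2 & hpos & ez & ez').
set (C := Rpower (Lam * rpow z (alpha + 2)) (/ (p - 2))).
assert (hC : 0 < C) by apply exp_pos.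
assert (hrz : 0 < rpow z (alpha + 2)) by (apply rpow_gt0; lra).
assert (hCp : rpow C (p - 1) = C * (Lam * (z * (z * rpow z alpha)))).
{ replace (p - 1) with (p - 2 + 1) by ring. rewrite rpow_succ, rpow_pos by lra. f_equal.
  unfold C. rewrite Rpower_mult, Rinv_l, Rpower_1 by (try lra; now apply Rmult_lt_0_compat).
  replace (alpha + 2) with (alpha + 1 + 1) by ring. now rewrite !rpow_succ by lra. }
exists (fun x => C * y (z * x)), (fun x => C * (z * y' (z * x))).
assert (hzx : forall x, -1 < x < 1 -> - z < z * x < z) by (intros; nra).
split.
- intros x. apply continuous_Rmult; [apply continuous_const |].
  apply (continuous_comp (fun t => z * t) y).
  + apply continuous_Rmult; [apply continuous_const | apply continuous_id].
  + apply (ex_derive_continuous y). eexists. apply h1.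
- intros x _. apply (is_derive_scal (fun t => y (z * t))), is_derive_scale_arg, h1.
- intros x hx.
  replace (- (rpow (Rabs x) alpha * rpow (C * y (z * x)) (p - 1)))
    with (C * (z * (z * truncated_force alpha p Lam (z * x) (y (z * x))))).
  + apply (is_derive_scal (fun t => z * y' (z * t))), (is_derive_scal (fun t => y' (z * t))).
    apply is_derive_scale_arg, h2.
  + assert (q1 := hzx x hx). assert (q2 := hpos _ q1).
    unfold truncated_force. rewrite !clamp_id by lra.
    rewrite Rabs_mult, (Rabs_pos_eq z), (Rabs_pos_eq (y _)) by lra.
    rewrite (rpow_mult_distr C), (rpow_mult_distr z), hCp by (try apply Rabs_pos; lra). ring.
- intros x hx. apply Rmult_lt_0_compat; [assumption |]. now apply hpos, hzx.
- replace (z * -1) with (- z) by ring. rewrite ez'. ring.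
- rewrite Rmult_1_r, ez. ring.
Qed.


Theorem theorem1p2 (alpha p : R) (halpha : 0 < alpha) (hp : 2 < p)
  (hcond : (p - 1) * (bessel_zero1 (- nu alpha) / bessel_zero1 (nu alpha)) ^ 2
             + c_ p * D_ alpha <= 1) :
  exists u : R -> R,
    henon_solution alpha p u
    /\ forall v : R -> R, henon_solution alpha p v ->
         forall x, -1 <= x <= 1 -> v x = u x.
Proof.
destruct (solution_exists alpha p halpha hp) as [u [u' hu]].
exists u. split; [now apply (classical_henon_solution alpha p u u') |].
intros v hv.
destruct (henon_solution_classical alpha p v hv) as [w [w' [hw hwv]]].
destruct (solution_even alpha p u u' halpha hp hu
  (spectral_gap alpha p u u' halpha hp hcond hu)) as [eu su].
destruct (solution_even alpha p w w' halpha hp hw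
  (spectral_gap alpha p w w' halpha hp hcond hw)) as [ew sw].
assert (h : forall x, 0 <= x <= 1 -> w x = u x).
{ intros x hx. destruct (Rle_dec (w 0) (u 0)).
  - now apply (even_solution_unique alpha p u u' w w').
  - symmetry. apply (even_solution_unique alpha p w w' u u'); try assumption. lra. }
intros x hx. rewrite <- hwv by assumption.
destruct (Rle_dec 0 x).
- apply h. lra.
- rewrite <- su, <- sw by assumption. apply h. lra.
Qed.
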